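(* Let $k$ be a field and $f=(f_1,\ldots,f_n):\mathbb{A}^n_k\to\mathbb{A}^n_k$ a morphism with only isolated zeros. Then the Bézoutian bilinear form of $f$ and the global Scheja--Storch bilinear form of $f$ are identical (as bilinear forms on $Q=k[x_1,\ldots,x_n]/(f_1,\ldots,f_n)$).
   Context: $Q=k[x_1,\ldots,x_n]/(f_1,\ldots,f_n)$ is a finite-dimensional $k$-algebra. For a linear form $\lambda:Q\to k$, $\Phi_\lambda:Q\times Q\to k$ denotes $\Phi_\lambda(a,b)=\lambda(ab)$. Bézoutian bilinear form: for $1\le i,j\le n$ let $$\Delta_{ij}:=\frac{f_i(Y_1,\ldots,Y_{j-1},X_j,\ldots,X_n)-f_i(Y_1,\ldots,Y_j,X_{j+1},\ldots,X_n)}{X_j-Y_j}\in k[X,Y],$$ and let the Bézoutian of $f$ be the image of $\det(\Delta_{ij})$ in $Q\otimes_kQ$ under $X_i\mapsto x_i\otimes1$, $Y_i\mapsto1\otimes x_i$. For a $k$-basis $\{a_i\}$ of $Q$, write the Bézoutian as $\sum_ia_i\otimes b_i$; then $\{b_i\}$ is also a basis, and the Bézoutian bilinear form is $\Phi_\lambda$ where $\lambda$ is the unique linear form with $\lambda(a_ib_j)=\delta_{ij}$ for all $i,j$ (independent of choices). Global Scheja--Storch form: let $P=k[x_1,\ldots,x_n]$. Choose $a_{ij}\in P\otimes_kP$ with $f_j\otimes1-1\otimes f_j=\sum_{i=1}^na_{ij}(x_i\otimes1-1\otimes x_i)$ for each $j$, and let $\Delta$ be the image of $\det(a_{ij})$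 in $Q\otimes_kQ$ (independent of choices). Let $\Theta:\operatorname{Hom}_k(Q,k)\to Q$ be the $k$-linear map corresponding to $\Delta$ under $b\otimes c\mapsto[\varphi\mapsto\varphi(b)c]$; it is an isomorphism. Put $\eta:=\Theta^{-1}(1)$. The global Scheja--Storch bilinear form is $\Phi_\eta$. *)

(* Defs.v *)
From HB Require Import structures.
From mathcomp Require Import all_boot all_order all_algebra.
From mathcomp Require Import boolp.
From mathcomp Require Import freeg mpoly.

Set Implicit Arguments.
Unset Strict Implicit.
Unset Printing Implicit Defensive.

Import GRing.Theory.

Local Open Scope ring_scope.
Local Open Scope quotient_scope.

Definition linear_basis (k : fieldType) (V : lmodType k) (d : nat)
    (a : 'I_d -> V) : Prop :=
  forall v : V, exists! c : {ffun 'I_d -> k}, v = \sum_i c i *: a i.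

(* ---------------------------------------------------------------------- *)
Section Tensor.

Variables (k : fieldType) (V W : lmodType k).

Local Notation F := {freeg (V * W)%type / k}.

Definition fpure (v : V) (w : W) : F := << (v, w) >>.

Inductive tensor_relator : F -> Prop :=
| TensorAddl v1 v2 w :
    tensor_relator (fpure (v1 + v2) w - (fpure v1 w + fpure v2 w))
| TensorAddr v w1 w2 :
    tensor_relator (fpure v (w1 + w2) - (fpure v w1 + fpure v w2))
| TensorScalel c v w : tensor_relator (fpure (c *: v) w - c *: fpure v w)
| TensorScaler c v w : tensor_relator (fpure v (c *: w) - c *: fpure v w).

(* The submodule of F generated by the relators. *)
Definition tensor_null : {pred F} := fun t : F =>
  `[< forall S : {pred F}, submod_closed S ->
        (forall r, tensor_relator r -> r \in S) -> t \in S >].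

Lemma tensor_nullP (t : F) :
  reflect (forall S : {pred F}, submod_closed S ->
             (forall r, tensor_relator r -> r \in S) -> t \in S)
          (t \in tensor_null).
Proof. exact: asboolP. Qed.

Lemma tensor_null_relator r : tensor_relator r -> r \in tensor_null.
Proof. by move=> rr; apply/tensor_nullP => S _; apply. Qed.

Lemma tensor_null_submod : submod_closed tensor_null.
Proof.
split; first by apply/tensor_nullP => S [].
move=> c u v /tensor_nullP uN /tensor_nullP vN; apply/tensor_nullP => S SS SR.
by case: (SS) => _; apply; [apply: uN | apply: vN].
Qed.

Lemma tensor_null_zmod : zmod_closed tensor_null.
Proof.
case: tensor_null_submod => N0 NS; split => // u v uN vN.
by rewrite addrC -scaleN1r NS.
Qed.

HB.instance Definition _ := GRing.isZmodClosed.Build F tensor_null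
  tensor_null_zmod.

Lemma tensor_nullZ c t : t \in tensor_null -> c *: t \in tensor_null.
Proof.
by case: tensor_null_submod => N0 NS tN; rewrite -[_ *: _]addr0 NS.
Qed.

Definition tensor : Type := @Quotient.quot F tensor_null.

HB.instance Definition _ := GRing.Zmodule.on tensor.
HB.instance Definition _ := Quotient.on tensor.

Definition tensor_class (t : F) : tensor := \pi_tensor t.

Lemma tensor_class_zmod_morphism : zmod_morphism tensor_class.
Proof. by move=> x y; rewrite /tensor_class !piE. Qed.

HB.instance Definition _ :=
  GRing.isZmodMorphism.Build F tensor tensor_class tensor_class_zmod_morphism.

Lemma tensor_class_eq0 t : (tensor_class t == 0) = (t \in tensor_null).
Proof.
by rewrite -[t in RHS]subr0 (Quotient.idealrBE tensor_null) !piE.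
Qed.

Lemma tensor_reprK (t : tensor) : tensor_class (repr t) = t.
Proof. exact: reprK. Qed.

Lemma tensor_class_eq t u :
  (tensor_class t = tensor_class u) <-> (t - u \in tensor_null).
Proof.
by rewrite -tensor_class_eq0 raddfB subr_eq0; split => /eqP.
Qed.

Definition tensor_scale (c : k) (t : tensor) : tensor :=
  tensor_class (c *: repr t).

Lemma tensor_scale_class c t :
  tensor_scale c (tensor_class t) = tensor_class (c *: t).
Proof.
apply/tensor_class_eq; rewrite -scalerBr; apply/tensor_nullZ/tensor_class_eq.
exact: tensor_reprK.
Qed.

Lemma tensor_scaleA a b t :
  tensor_scale a (tensor_scale b t) = tensor_scale (a * b) t.
Proof. by rewrite -[t]tensor_reprK !tensor_scale_class scalerA. Qed.

Lemma tensor_scale1 : left_id 1 tensor_scale.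
Proof. by move=> t; rewrite -[t]tensor_reprK !tensor_scale_class scale1r. Qed.

Lemma tensor_scaleDr : right_distributive tensor_scale +%R.
Proof.
move=> c t u; rewrite -[t]tensor_reprK -[u]tensor_reprK -raddfD.
by rewrite !tensor_scale_class scalerDr raddfD.
Qed.

Lemma tensor_scaleDl t : {morph tensor_scale^~ t : a b / a + b}.
Proof.
move=> a b; rewrite -[t]tensor_reprK !tensor_scale_class scalerDl.
by rewrite raddfD.
Qed.

HB.instance Definition _ := GRing.Zmodule_isLmodule.Build k tensor
  tensor_scaleA tensor_scale1 tensor_scaleDr tensor_scaleDl.

Definition tens (v : V) (w : W) : tensor := tensor_class (fpure v w).

Lemma tensorZ_class c t : c *: tensor_class t = tensor_class (c *: t).
Proof. exact: tensor_scale_class. Qed.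

Lemma tensDl v1 v2 w : tens (v1 + v2) w = tens v1 w + tens v2 w.
Proof.
rewrite /tens -raddfD; apply/tensor_class_eq/tensor_null_relator.
exact: TensorAddl.
Qed.

Lemma tensDr v w1 w2 : tens v (w1 + w2) = tens v w1 + tens v w2.
Proof.
rewrite /tens -raddfD; apply/tensor_class_eq/tensor_null_relator.
exact: TensorAddr.
Qed.

Lemma tensZl c v w : tens (c *: v) w = c *: tens v w.
Proof.
rewrite /tens tensorZ_class; apply/tensor_class_eq/tensor_null_relator.
exact: TensorScalel.
Qed.

Lemma tensZr c v w : tens v (c *: w) = c *: tens v w.
Proof.
rewrite /tens tensorZ_class; apply/tensor_class_eq/tensor_null_relator.
exact: TensorScaler.
Qed.

Lemma freeg_span (t : F) :
  t = \sum_(x <- dom t) coeff x t *: fpure x.1 x.2.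
Proof.
rewrite -[LHS]freeg_sumE; apply: eq_bigr => -[v w] _.
by apply/eqP/freeg_eqP => x; rewrite coeffZ !coeffU mul1r.
Qed.

Lemma tensor_ind (P : tensor -> Prop) :
  P 0 -> (forall c v w t, P t -> P (c *: tens v w + t)) -> forall t, P t.
Proof.
move=> P0 PS t; rewrite -[t]tensor_reprK [repr t]freeg_span raddf_sum /=.
elim: (dom _) => [|x s IH]; first by rewrite big_nil.
by rewrite big_cons -tensorZ_class; apply: PS.
Qed.

Section Lift.

Variables (U : lmodType k) (beta : V -> W -> U).

(* The linear map tensor -> U induced by beta. It depends on the chosen
   representative unless beta is bilinear. *)
Definition tensor_lift (t : tensor) : U :=
  fglift (fun x : V * W => beta x.1 x.2) (repr t).

Hypothesis beta_l : forall w, linear (beta^~ w).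
Hypothesis beta_r : forall v, linear (beta v).

Let beta_l0 w : beta 0 w = 0.
Proof. by have := beta_l w (-1) 0 0; rewrite scaler0 addr0 scaleN1r addNr. Qed.
Let beta_r0 v : beta v 0 = 0.
Proof. by have := beta_r v (-1) 0 0; rewrite scaler0 addr0 scaleN1r addNr. Qed.

Local Notation G := (fglift (fun x : V * W => beta x.1 x.2)).

Let G_additive : zmod_morphism G. Proof. exact: lift_is_additive. Qed.
HB.instance Definition _ := GRing.isZmodMorphism.Build F U G G_additive.

Let G_scale c t : G (c *: t) = c *: G t.
Proof.
rewrite [t]freeg_span scaler_sumr raddf_sum [in RHS]raddf_sum scaler_sumr /=.
apply: eq_bigr => -[v w] _; rewrite scalerA.
have GU a : G (a *: fpure v w) = a *: beta v w.
  rewrite (_ : a *: fpure v w = << a *g (v, w) >>) ?liftU //.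
  by apply/eqP/freeg_eqP => x; rewrite coeffZ !coeffU mul1r.
by rewrite !GU scalerA.
Qed.

Let G_pure v w : G (fpure v w) = beta v w.
Proof. by rewrite liftU scale1r. Qed.

Let G_null t : t \in tensor_null -> G t = 0.
Proof.
move=> /tensor_nullP /(_ (fun t => G t == 0)) tN; apply/eqP/tN.
  split=> [|c u v]; rewrite !unfold_in /=; first by rewrite raddf0.
  by move=> /eqP u0 /eqP v0; rewrite raddfD /= G_scale u0 v0 scaler0 addr0.
move=> r; rewrite unfold_in => -[v1 v2 w|v w1 w2|c v w|c v w] /=;
  rewrite raddfB ?raddfD /= ?G_scale !G_pure.
- by have /= := beta_l w 1 v1 v2; rewrite !scale1r => ->; rewrite -opprD subrr.
- by have /= := beta_r v 1 w1 w2; rewrite !scale1r => ->; rewrite -opprD subrr.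
- by have /= := beta_l w c v 0; rewrite beta_l0 !addr0 => ->; rewrite subrr.
- by have /= := beta_r v c w 0; rewrite beta_r0 !addr0 => ->; rewrite subrr.
Qed.

Let lift_class t : tensor_lift (tensor_class t) = G t.
Proof.
apply/eqP; rewrite -subr_eq0 -raddfB; apply/eqP/G_null.
by apply/tensor_class_eq; rewrite tensor_reprK.
Qed.

Lemma tensor_lift_tens v w : tensor_lift (tens v w) = beta v w.
Proof. by rewrite lift_class G_pure. Qed.

Lemma tensor_lift_linear : linear tensor_lift.
Proof.
move=> c t u; rewrite -[t]tensor_reprK -[u]tensor_reprK tensorZ_class -raddfD.
by rewrite !lift_class raddfD /= G_scale.
Qed.

End Lift.

End Tensor.

Notation "v ⊗ w" := (tens v w) (at level 40, left associativity) : ring_scope.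

(* ---------------------------------------------------------------------- *)
Section TensorAlgebra.

Variables (k : fieldType) (A B : comAlgType k).

Local Notation T := (tensor A B).

Definition tensor_one : T := (1 : A) ⊗ (1 : B).

(* (a ⊗ b) * (a' ⊗ b') = (a * a') ⊗ (b * b') *)
Definition tensor_mul (t u : T) : T :=
  tensor_lift (fun a b =>
    tensor_lift (fun a' b' => (a * a') ⊗ (b * b')) u) t.

Let inner (a : A) (b : B) (u : T) : T :=
  tensor_lift (fun a' b' => (a * a') ⊗ (b * b')) u.

Let inner_l a b b' : linear (fun a' => (a * a') ⊗ (b * b') : T).
Proof. by move=> c x y; rewrite mulrDr -scalerAr tensDl tensZl. Qed.
Let inner_r a b a' : linear (fun b' => (a * a') ⊗ (b * b') : T).
Proof. by move=> c x y; rewrite mulrDr -scalerAr tensDr tensZr. Qed.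

Let inner_tens a b a' b' : inner a b (a' ⊗ b') = (a * a') ⊗ (b * b').
Proof. exact: (tensor_lift_tens (inner_l a b) (inner_r a b)). Qed.

Let inner_linear a b : linear (inner a b).
Proof. exact: (tensor_lift_linear (inner_l a b) (inner_r a b)). Qed.

Let inner0 a b : inner a b 0 = 0.
Proof.
have := inner_linear a b (-1) 0 0.
by rewrite scaler0 addr0 scaleN1r addNr.
Qed.

Let outer_l u b : linear (fun a => inner a b u).
Proof.
move=> c x y; elim/tensor_ind: u => [|d v w u IH].
  by rewrite !inner0 scaler0 addr0.
rewrite !inner_linear IH !inner_tens mulrDl -scalerAl tensDl tensZl.
by rewrite !scalerDr !scalerA [d * c]mulrC addrACA.
Qed.

Let outer_r u a : linear (fun b => inner a b u).
Proof.
move=> c x y; elim/tensor_ind: u => [|d v w u IH].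
  by rewrite !inner0 scaler0 addr0.
rewrite !inner_linear IH !inner_tens mulrDl -scalerAl tensDr tensZr.
by rewrite !scalerDr !scalerA [d * c]mulrC addrACA.
Qed.

Let mul_inner a b u : tensor_mul (a ⊗ b) u = inner a b u.
Proof. exact: (tensor_lift_tens (outer_l u) (outer_r u)). Qed.

Let mul_lin u : linear (tensor_mul^~ u).
Proof. exact: (tensor_lift_linear (outer_l u) (outer_r u)). Qed.

Let mul0 u : tensor_mul 0 u = 0.
Proof. by have := mul_lin u (-1) 0 0; rewrite scaler0 addr0 scaleN1r addNr. Qed.

Lemma tensor_mul_tens a b a' b' :
  tensor_mul (a ⊗ b) (a' ⊗ b') = (a * a') ⊗ (b * b').
Proof. by rewrite mul_inner inner_tens. Qed.

Lemma tensor_mulC : commutative tensor_mul.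
Proof.
move=> t u; elim/tensor_ind: t => [|c a b t IHt].
  rewrite mul0; elim/tensor_ind: u => [|c a b u IHu]; first by rewrite mul0.
  by rewrite mul_lin -IHu addr0 mul_inner inner0 scaler0.
rewrite mul_lin IHt; elim/tensor_ind: u {IHt} => [|d a' b' u IHu].
  by rewrite !mul0 mul_inner inner0 scaler0 addr0.
rewrite !mul_lin mul_inner inner_linear inner_tens !mul_inner.
rewrite !inner_linear !inner_tens -IHu mul_inner !scalerDr !scalerA.
rewrite [a' * a]mulrC [b' * b]mulrC [d * c]mulrC -!addrA; congr (_ + _).
by rewrite addrCA.
Qed.

Lemma tensor_mulA : associative tensor_mul.
Proof.
have linr x : linear (tensor_mul x).
  by move=> c y z; rewrite ![tensor_mul x _]tensor_mulC mul_lin.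
have mulr0' x : tensor_mul x 0 = 0 by rewrite tensor_mulC mul0.
move=> t u v; elim/tensor_ind: t => [|c a b t IHt]; first by rewrite !mul0.
rewrite !mul_lin IHt; congr (_ *: _ + _) => {IHt}.
elim/tensor_ind: u => [|d a' b' u IHu]; first by rewrite !(mulr0', mul0).
rewrite !(mul_lin, linr) IHu; congr (_ *: _ + _) => {IHu}.
elim/tensor_ind: v => [|e a'' b'' v IHv]; first by rewrite !(mulr0', mul0).
by rewrite !linr IHv !tensor_mul_tens !mulrA.
Qed.

Lemma tensor_mul1 : left_id tensor_one tensor_mul.
Proof.
move=> t; rewrite /tensor_one mul_inner.
elim/tensor_ind: t => [|c a b t IH]; first by rewrite inner0.
by rewrite inner_linear IH inner_tens !mul1r.
Qed.

Lemma tensor_mulDl : left_distributive tensor_mul +%R.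
Proof. by move=> t u v; rewrite -[t]scale1r mul_lin !scale1r. Qed.

HB.instance Definition _ := GRing.Zmodule_isComPzRing.Build T
  tensor_mulA tensor_mulC tensor_mul1 tensor_mulDl.

End TensorAlgebra.

(* ---------------------------------------------------------------------- *)
Section QuotientAlgebra.

Variables (k : fieldType) (n : nat) (f : 'I_n -> {mpoly k[n]}).

Local Notation P := {mpoly k[n]}.

Definition generated_ideal : {pred P} := fun p : P =>
  `[< exists g : 'I_n -> P, p = \sum_i g i * f i >].

Lemma generated_idealP (p : P) :
  reflect (exists g : 'I_n -> P, p = \sum_i g i * f i) (p \in generated_ideal).
Proof. exact: asboolP. Qed.

Lemma generated_ideal_zmod : zmod_closed generated_ideal.
Proof.
split=> [|p q /generated_idealP[g ->] /generated_idealP[h ->]].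
  apply/generated_idealP; exists (fun=> 0).
  by rewrite big1 // => i _; rewrite mul0r.
apply/generated_idealP; exists (fun i => g i - h i).
by rewrite -sumrB; apply: eq_bigr => i _; rewrite mulrBl.
Qed.

HB.instance Definition _ := GRing.isZmodClosed.Build P generated_ideal
  generated_ideal_zmod.

Lemma generated_idealM p q : q \in generated_ideal -> p * q \in generated_ideal.
Proof.
move=> /generated_idealP[g ->]; apply/generated_idealP.
exists (fun i => p * g i).
by rewrite mulr_sumr; apply: eq_bigr => i _; rewrite mulrA.
Qed.

Definition quotient_algebra : Type := @Quotient.quot P generated_ideal.

Local Notation Q := quotient_algebra.

HB.instance Definition _ := GRing.Zmodule.on Q.
HB.instance Definition _ := Quotient.on Q.

Definition residue (p : P) : Q := \pi_Q p.

Lemma residue_zmod_morphism : zmod_morphism residue.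
Proof. by move=> x y; rewrite /residue !piE. Qed.

HB.instance Definition _ :=
  GRing.isZmodMorphism.Build P Q residue residue_zmod_morphism.

Lemma residue_eq0 p : (residue p == 0) = (p \in generated_ideal).
Proof.
by rewrite -[p in RHS]subr0 (Quotient.idealrBE generated_ideal) !piE.
Qed.

Lemma residue_eq p q : residue p = residue q <-> p - q \in generated_ideal.
Proof.
by rewrite -residue_eq0 raddfB subr_eq0; split => /eqP.
Qed.

Lemma residue_reprK (x : Q) : residue (repr x) = x.
Proof. exact: reprK. Qed.

Definition quotient_mul (x y : Q) : Q := residue (repr x * repr y).

Lemma quotient_mul_residue p q :
  quotient_mul (residue p) (residue q) = residue (p * q).
Proof.
set p' := repr (residue p); set q' := repr (residue q).
have p'E : p' - p \in generated_ideal by apply/residue_eq/residue_reprK.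
have q'E : q' - q \in generated_ideal by apply/residue_eq/residue_reprK.
apply/residue_eq; rewrite -/p' -/q'.
rewrite (_ : _ - _ = q' * (p' - p) + p * (q' - q)).
  by rewrite rpredD // generated_idealM.
by rewrite !mulrBr [q' * p']mulrC [q' * p]mulrC addrA subrK.
Qed.

Lemma quotient_mulA : associative quotient_mul.
Proof.
move=> x y z; rewrite -[x]residue_reprK -[y]residue_reprK -[z]residue_reprK.
by rewrite !quotient_mul_residue mulrA.
Qed.

Lemma quotient_mulC : commutative quotient_mul.
Proof. by move=> x y; rewrite /quotient_mul mulrC. Qed.

Lemma quotient_mul1 : left_id (residue 1) quotient_mul.
Proof.
by move=> x; rewrite -[x]residue_reprK quotient_mul_residue mul1r.
Qed.

Lemma quotient_mulDl : left_distributive quotient_mul +%R.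
Proof.
move=> x y z; rewrite -[x]residue_reprK -[y]residue_reprK -[z]residue_reprK.
by rewrite -raddfD !quotient_mul_residue mulrDl raddfD.
Qed.

(* Q is the zero ring when f has no zeros, hence ComPzRing. *)
HB.instance Definition _ := GRing.Zmodule_isComPzRing.Build Q
  quotient_mulA quotient_mulC quotient_mul1 quotient_mulDl.

Lemma residue1 : residue 1 = 1. Proof. by []. Qed.

Lemma residueM : {morph residue : p q / p * q}.
Proof. by move=> p q; rewrite -quotient_mul_residue. Qed.

HB.instance Definition _ :=
  GRing.isMonoidMorphism.Build P Q residue (residue1, residueM).

Definition quotient_scale (c : k) (x : Q) : Q := residue c%:MP * x.

Lemma quotient_scale_residue c p : quotient_scale c (residue p) = residue (c *: p).
Proof. by rewrite /quotient_scale -rmorphM mul_mpolyC. Qed.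

Lemma quotient_scaleA a b x :
  quotient_scale a (quotient_scale b x) = quotient_scale (a * b) x.
Proof. by rewrite /quotient_scale mpolyCM rmorphM mulrA. Qed.

Lemma quotient_scale1 : left_id 1 quotient_scale.
Proof. by move=> x; rewrite /quotient_scale rmorph1 mul1r. Qed.

Lemma quotient_scaleDr : right_distributive quotient_scale +%R.
Proof. by move=> c x y; rewrite /quotient_scale mulrDr. Qed.

Lemma quotient_scaleDl x : {morph quotient_scale^~ x : a b / a + b}.
Proof. by move=> a b; rewrite /quotient_scale mpolyCD raddfD mulrDl. Qed.

HB.instance Definition _ := GRing.Zmodule_isLmodule.Build k Q
  quotient_scaleA quotient_scale1 quotient_scaleDr quotient_scaleDl.

Lemma residueZ : scalable residue.
Proof. by move=> c p; rewrite -quotient_scale_residue. Qed.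

HB.instance Definition _ := GRing.isScalable.Build k P Q *:%R residue residueZ.

End QuotientAlgebra.

(* ---------------------------------------------------------------------- *)
Section IsolatedZeros.

Variables (k : fieldType) (n : nat).

Local Notation P := {mpoly k[n]}.

Definition prime_ideal (p : {pred P}) : Prop :=
  idealr_closed p /\ prime_idealr_closed p.

(* idealr_closed includes properness. *)
Definition maximal_ideal (m : {pred P}) : Prop :=
  idealr_closed m /\
  forall J : {pred P}, idealr_closed J -> {subset m <= J} -> J =i m.

Definition vanishes_at (f : 'I_n -> P) (p : {pred P}) : Prop :=
  forall i, f i \in p.

(* Every closed point m of the zero scheme V(f) = Spec k[x]/(f) is isolated:
   some basic open neighbourhood {g != 0} of m meets V(f) in {m} only. *)
Definition only_isolated_zeros (f : 'I_n -> P) : Prop :=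
  forall m : {pred P}, maximal_ideal m -> vanishes_at f m ->
    exists2 g : P, g \notin m &
      forall p : {pred P}, prime_ideal p -> vanishes_at f p -> g \notin p ->
        p =i m.

End IsolatedZeros.

(* ---------------------------------------------------------------------- *)
Section Forms.

Variables (k : fieldType) (n : nat) (f : 'I_n -> {mpoly k[n]}).

Local Notation P := {mpoly k[n]}.
Local Notation Q := (quotient_algebra f).

Definition mult_form (lambda : {linear Q -> k^o}) : Q -> Q -> k :=
  fun a b => lambda (a * b).

(* k[X, Y] is {mpoly k[n + n]}, the X's coming first. *)
Definition bigX (i : 'I_n) : {mpoly k[n + n]} := 'X_(lshift n i).
Definition bigY (i : 'I_n) : {mpoly k[n + n]} := 'X_(rshift n i).

(* p(Y_1, ..., Y_j, X_(j+1), ..., X_n), where j : nat is the number of Y's *)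
Definition subst_YX (j : nat) (p : P) : {mpoly k[n + n]} :=
  p \mPo [tuple if (l < j)%N then bigY l else bigX l | l < n].

(* The quotient defining Delta_ij is the unique solution of this equation in
   the domain k[X, Y]; with 0-based j, the first term has j Y's and the second
   has j.+1. *)
Definition bezout_matrix (D : 'M[{mpoly k[n + n]}]_n) : Prop :=
  forall i j : 'I_n,
    D i j * (bigX j - bigY j) = subst_YX j (f i) - subst_YX j.+1 (f i).

Definition residue2 (t : tensor P P) : tensor Q Q :=
  tensor_lift (fun p q => residue f p ⊗ residue f q) t.

(* The algebra morphism k[X, Y] -> P ⊗ P, X_i |-> x_i ⊗ 1, Y_i |-> 1 ⊗ x_i,
   spelled out because mmap wants its target in nzRingType. *)
Definition bezout_var (i : 'I_(n + n)) : tensor P P :=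
  match split i with
  | inl j => ('X_j : P) ⊗ (1 : P)
  | inr j => (1 : P) ⊗ ('X_j : P)
  end.

Definition bezout_eval (p : {mpoly k[n + n]}) : tensor P P :=
  \sum_(m <- msupp p) p@_m *: \prod_(i < n + n) bezout_var i ^+ m i.

Definition is_bezoutian_form (B : Q -> Q -> k) : Prop :=
  exists (D : 'M[{mpoly k[n + n]}]_n) (d : nat) (a b : 'I_d -> Q)
         (lambda : {linear Q -> k^o}),
    [/\ bezout_matrix D,
        linear_basis a,
        residue2 (bezout_eval (\det D)) = \sum_i a i ⊗ b i,
        forall i j, lambda (a i * b j) = (i == j)%:R &
        B = mult_form lambda].

Definition scheja_storch_matrix (a : 'M[tensor P P]_n) : Prop :=
  forall j : 'I_n,
    f j ⊗ (1 : P) - (1 : P) ⊗ f j =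
      \sum_i a i j * (('X_i : P) ⊗ (1 : P) - (1 : P) ⊗ ('X_i : P)).

Definition contract (t : tensor Q Q) (phi : {linear Q -> k^o}) : Q :=
  tensor_lift (fun b c => (phi b : k) *: c) t.

Definition is_scheja_storch_form (B : Q -> Q -> k) : Prop :=
  exists (a : 'M[tensor P P]_n) (eta : {linear Q -> k^o}),
    [/\ scheja_storch_matrix a,
        contract (residue2 (\det a)) eta = 1 &
        B = mult_form eta].

End Forms.

(* Main.v *)
Require Import Defs.
From HB Require Import structures.
From mathcomp Require Import all_boot all_order all_algebra.
From mathcomp Require Import ring_quotient boolp.
From mathcomp Require classical_sets.
From mathcomp Require Import mpoly ssrcomplements.

Set Implicit Arguments.
Unset Strict Implicit.
Unset Printing Implicit Defensive.

Import GRing.Theory.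

Local Open Scope ring_scope.
Local Open Scope quotient_scope.

(** Write [Delta] for the class in [Q ⊗ Q] of the determinant of a matrix [a]
    with [f_j(X) - f_j(Y) = \sum_i a_ij (X_i - Y_i)].  Transposed, the matrix of
    difference quotients that defines the Bezoutian is such a matrix, because its
    rows telescope.  So both forms are [Phi_eta] for a functional [eta] tied to
    [Delta], and four facts make [eta] exist, be unique and be the same.

    - The class [Delta] is independent of the matrix ([det_congruence]).  The
      differences [X_i - Y_i] form a regular sequence, hence two matrices differ
      column by column by Koszul syzygies, and each of these changes the
      determinant by an element of the ideal of the [f_j(X) - f_j(Y)].

    - Some [eta] contracts [Delta] to [1] ([contract_quotient_functional]).  By the
      next fact there are nonconstant monic [G_i] in one variable with
      [G_i(x_i) = \sum_j b_ij f_j].  For the sequence [G_i(x_i)] everything is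
      explicit: the Bezoutian is the product of the difference quotients of the
      [G_i], and it is contracted to [1] by the functional [l] that reads the
      coefficient of [\prod_i x_i^(deg G_i - 1)] in the remainder modulo the [G_i].
      The functional [p |-> l (det b * p)] kills the [f_j] by Cramer's rule, and the
      first fact, applied to the sequence [G_i(x_i)], shows that it contracts [Delta]
      to [1] ([slice_transformation]).

    - Isolated zeros make every [x_i] algebraic over [k] modulo [f]
      ([isolated_zeros_univariate]), hence [Q] finite-dimensional.  If
      [x_i] satisfied no polynomial modulo [f], take an ideal containing [f] and
      maximal among those that contain no [h(x_i)] with [h != 0].  It is prime, and
      isolation forces it to be a maximal ideal; its residue field is a finitely
      generated [k]-algebra in which [x_i] is transcendental, against Zariski's
      lemma ([finitely_generated_field_algebraic]).

    - The rest is linear algebra.  By Cramer's rule [p ⊗ 1 - 1 ⊗ p] kills [Delta],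
      so contracting [Delta] with [phi (x * _)] gives [x] times its contraction with
      [phi] ([contract_shift]).  If [eta] contracts [Delta = \sum_i a_i ⊗ b_i] to [1],
      then [x = \sum_i eta (x a_i) b_i] for all [x]; for a basis [a] this says that
      two square matrices are inverse to each other, which is the duality
      [eta (a_i b_j) = delta_ij] ([dual_basis]).  Conversely a functional for which
      [a] and [b] are dual contracts [Delta] to [1] ([bezoutian_contract1]), and only
      one functional does ([contract1_unique]). *)

(** * Zariski's lemma *)

Section Adjunction.
Variable L : idomainType.
Implicit Types (S : subringClosed L) (x : L).

Definition adjoin (S : {pred L}) x : {pred L} :=
  fun y => `[< exists2 q : {poly L}, q \is a polyOver S & y = q.[x] >].

Lemma adjoinP (S : {pred L}) x y :
  reflect (exists2 q : {poly L}, q \is a polyOver S & y = q.[x]) (y \in adjoin S x).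
Proof. exact: asboolP. Qed.

Lemma adjoin_subring S x : subring_closed (adjoin S x).
Proof.
split=> [|_ _ /adjoinP[p Sp ->] /adjoinP[q Sq ->]|_ _ /adjoinP[p Sp ->] /adjoinP[q Sq ->]].
- by apply/adjoinP; exists 1; rewrite ?rpred1 ?hornerE.
- by apply/adjoinP; exists (p - q); rewrite ?rpredB ?hornerE.
- by apply/adjoinP; exists (p * q); rewrite ?rpredM ?hornerE.
Qed.

HB.instance Definition _ S x :=
  GRing.isSubringClosed.Build L (adjoin S x) (adjoin_subring S x).

(** Euclidean division over the subring [S], where leading coefficients need not be
    invertible: a power of the leading coefficient of the divisor pays for it. *)
Lemma pseudo_division S (p q : {poly L}) :
    p \is a polyOver S -> q \is a polyOver S -> q != 0 ->
  exists e s r, [/\ s \is a polyOver S, r \is a polyOver S,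
    (size r < size q)%N & lead_coef q ^+ e *: p = s * q + r].
Proof.
move=> Sp Sq q0; elim/ltn_ind: {p}(size p) {-2}p (leqnn (size p)) Sp => m IH p le_pm Sp.
have Sc : lead_coef q \in S by apply/polyOverP.
have [lt_pq|le_qp] := ltnP (size p) (size q).
  by exists 0, 0, p; rewrite rpred0 expr0 scale1r mul0r add0r.
have p0 : p != 0 by rewrite -size_poly_gt0 (leq_trans _ le_qp) ?size_poly_gt0.
pose t := lead_coef p *: 'X^(size p - size q).
have St : t \is a polyOver S by rewrite polyOverZ ?rpredX ?polyOverX //; apply/polyOverP.
pose p' := lead_coef q *: p - t * q.
have lt_p' : (size p' < size p)%N.
  have szt : size (t * q) = size p.
    rewrite /t -scalerAl size_scale ?lead_coef_eq0 // mulrC size_mulXn //.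
    by rewrite subnK.
  have ltq: (0 < size p)%N by rewrite size_poly_gt0.
  rewrite -(prednK ltq) ltnS; apply/leq_sizeP => j; rewrite leq_eqVlt => /predU1P[<-|lt_j].
    rewrite coefB coefZ -lead_coefE -[in X in _ - X]szt -lead_coefE lead_coefM /t.
    by rewrite lead_coefZ lead_coefXn mulr1 mulrC subrr.
  rewrite (prednK ltq) in lt_j.
  rewrite nth_default // (leq_trans (size_polyD _ _)) // geq_max size_polyN szt lt_j.
  by rewrite (leq_trans (size_scale_leq _ _)).
have Sp' : p' \is a polyOver S by rewrite rpredB ?polyOverZ ?rpredM.
have [e [s [r [Ss Sr lt_r Er]]]] := IH _ (leq_trans lt_p' le_pm) _ (leqnn _) Sp'.
exists e.+1, (lead_coef q ^+ e *: t + s), r; split=> //.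
  by rewrite rpredD // polyOverZ ?rpredX.
rewrite exprSr -scalerA; have -> : lead_coef q *: p = t * q + p' by rewrite addrC subrK.
by rewrite scalerDr Er scalerAl mulrDl addrA.
Qed.

Lemma mem_adjoin_horner S x q : q \is a polyOver S -> q.[x] \in adjoin S x.
Proof. by move=> Sq; apply/adjoinP; exists q. Qed.

Lemma sub_adjoin S x y : y \in S -> y \in adjoin S x.
Proof. by move=> Sy; rewrite -[y](hornerC y x) mem_adjoin_horner // polyOverC. Qed.

Lemma mem_adjoin S x : x \in adjoin S x.
Proof. by rewrite -{1}[x]hornerX mem_adjoin_horner // polyOverX. Qed.

Definition algebraic S x :=
  exists q : {poly L}, [/\ q \is a polyOver S, q != 0 & q.[x] = 0].

(** The units of the localization [A_a] that lie in [S] are units of [S_d].  An element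
    [w] is a unit of [A_a] exactly when it divides a power of [a]; in this form the
    statement needs no localization, and it passes along a chain of extensions. *)
Definition unit_descent S (A : {pred L}) (a d : L) := forall w, w \in S ->
  (exists N, exists2 u, u \in A & w * u = a ^+ N) ->
  (exists N, exists2 v, v \in S & w * v = d ^+ N).

(** Leading coefficients are multiplicative, so [d] can be the leading coefficient of
    [a] as a polynomial in [x]. *)
Lemma unit_descent_transcendental S x a :
    ~ algebraic S x -> a \in adjoin S x -> a != 0 ->
  exists d, [/\ d \in S, d != 0 & unit_descent S (adjoin S x) a d].
Proof.
move=> Nx /adjoinP[q Sq ->] qx0.
have inj p : p \is a polyOver S -> p.[x] = 0 -> p = 0.
  by move=> Sp px; apply/eqP/negP => /negP p0; apply: Nx; exists p.
exists (lead_coef q); split; first exact/polyOverP.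
  by apply: contraNneq qx0 => /eqP; rewrite lead_coef_eq0 => /eqP->; rewrite horner0.
move=> w Sw [N [_ /adjoinP[r Sr ->] E]]; exists N, (lead_coef r); first exact/polyOverP.
have /eqP : w *: r - q ^+ N = 0.
  apply: inj; first by rewrite rpredB ?polyOverZ ?rpredX.
  by rewrite hornerD hornerN hornerZ horner_exp E subrr.
rewrite subr_eq0 => /eqP Er.
by rewrite -lead_coefZ Er lead_coef_exp.
Qed.

Lemma minimal_relation S x : algebraic S x -> exists p : {poly L},
  [/\ p \is a polyOver S, p != 0, p.[x] = 0 &
    forall q, q \is a polyOver S -> (size q < size p)%N -> q.[x] = 0 -> q = 0].
Proof.
move=> [p0 [Sp0 p00 px0]].
have ex : exists m, `[< exists p : {poly L},
   [/\ p \is a polyOver S, p != 0, p.[x] = 0 & size p = m] >].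
  by exists (size p0); apply/asboolP; exists p0.
case: (ex_minnP ex) => m /asboolP[p [Sp pn0 px szp]] min_m.
exists p; split=> // q Sq; rewrite szp => lt_q qx; apply/eqP/negP => /negP q0.
have : (m <= size q)%N by apply/min_m/asboolP; exists q.
by rewrite leqNgt lt_q.
Qed.

(** A value [q.[x]] that is a nonzero multiple of [a] and comes from a [q] of least
    degree must come from a constant: otherwise dividing the minimal relation of [x] by
    [q] leaves a remainder giving a multiple of [a] of smaller degree. *)
Lemma multiple_in_base S x a :
    algebraic S x -> a \in adjoin S x -> a != 0 ->
  exists v, [/\ v \in adjoin S x, a * v \in S & a * v != 0].
Proof.
move=> /minimal_relation[p [Sp p0 px min_p]] Aa a0.
have Sc : lead_coef p \in S by apply/polyOverP.
have c0 : lead_coef p != 0 by rewrite lead_coef_eq0.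
have ex : exists m, `[< exists q v, [/\ q \is a polyOver S, v \in adjoin S x,
     q.[x] = a * v, q.[x] != 0 & size q = m] >].
  case/adjoinP: (Aa) => q Sq Eq; exists (size q); apply/asboolP; exists q, 1.
  by rewrite rpred1 mulr1 -Eq.
case: (ex_minnP ex) => m /asboolP[q [v [Sq Av Eq qx0 szq]]] min_m.
have q0 : q != 0 by apply: contraNneq qx0 => ->; rewrite horner0.
have lt_m : (m < size p)%N.
  have [e [s [r [Ss Sr lt_r Er]]]] := pseudo_division Sq Sp p0.
  apply: leq_ltn_trans lt_r; apply/min_m/asboolP; exists r, (lead_coef p ^+ e * v).
  have Erx : r.[x] = lead_coef p ^+ e * q.[x].
    by rewrite -hornerZ Er !hornerE px mulr0 add0r.
  split=> //; last by rewrite Erx mulf_neq0 ?expf_neq0.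
    by rewrite rpredM // sub_adjoin // rpredX.
  by rewrite Erx Eq mulrCA.
have m1 : (m <= 1)%N.
  rewrite leqNgt; apply/negP => m2.
  have [e [s [r [Ss Sr lt_r Er]]]] := pseudo_division Sp Sq q0.
  have Erx : r.[x] = a * (- v * s.[x]).
    have /(congr1 (horner^~ x)) := Er; rewrite !hornerE px mulr0 => /esym/eqP.
    rewrite addrC addr_eq0 => /eqP->.
    by rewrite Eq /= mulrN mulNr mulrC.
  have rx : r.[x] = 0.
    apply/eqP/negP => /negP rx0.
    have : (m <= size r)%N.
      apply/min_m/asboolP; exists r, (- v * s.[x]).
      by rewrite rpredM ?rpredN ?mem_adjoin_horner.
    by rewrite leqNgt -szq lt_r.
  have r0 : r = 0 by apply: min_p => //; rewrite (ltn_trans lt_r) ?szq.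
  have sx : s.[x] = 0.
    have /(congr1 (horner^~ x)) := Er; rewrite r0 !hornerE px mulr0 => /esym/eqP.
    by rewrite mulf_eq0 (negPf qx0) orbF => /eqP.
  have Esp : lead_coef q ^+ e *: p = s * q by rewrite Er r0 addr0.
  have s0 : s != 0.
    apply/eqP => s0; move/eqP: Esp; rewrite s0 mul0r -mul_polyC mulf_eq0 polyC_eq0 (negPf p0) orbF.
    by rewrite expf_eq0 lead_coef_eq0 (negPf q0) andbF.
  have : (size s < size p)%N.
    have := congr1 (fun t : {poly L} => size t) Esp.
    rewrite size_scale ?expf_neq0 ?lead_coef_eq0 // size_mul // szq => ->.
    by case: m m2 {min_m lt_m szq} => [|[|m]] // _; rewrite addnS /= addnS ltnS leq_addr.
  by move=> lt_s; case/eqP: s0; apply: min_p.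
exists v; rewrite -Eq; split=> //.
rewrite (size1_polyC (p := q)) ?szq // hornerC; exact/polyOverP.
Qed.

(** Replacing [a] by a multiple [a * v] in [S] turns [w * u = a ^+ N] into an equation
    with right-hand side in [S].  Below the degree of the minimal relation the
    representation of an element by powers of [x] is unique, hence comparing constant
    coefficients gives a division in [S], up to powers of the leading coefficient that
    the reduction costs. *)
Lemma unit_descent_algebraic S x a :
    algebraic S x -> a \in adjoin S x -> a != 0 ->
  exists d, [/\ d \in S, d != 0 & unit_descent S (adjoin S x) a d].
Proof.
move=> algx Aa a0; have [v [Av Sav av0]] := multiple_in_base algx Aa a0.
have [p [Sp p0 px min_p]] := minimal_relation algx.
have Sc : lead_coef p \in S by apply/polyOverP.
have c0 : lead_coef p != 0 by rewrite lead_coef_eq0.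
exists (lead_coef p * (a * v)); split; [exact: rpredM | exact: mulf_neq0 |].
move=> w Sw [N [u Au Eu]].
have [q Sq Eq] : exists2 q, q \is a polyOver S & u * v ^+ N = q.[x].
  by apply/adjoinP; rewrite rpredM ?rpredX.
have [e [s [r [Ss Sr lt_r Er]]]] := pseudo_division Sq Sp p0.
have Erx : r.[x] = lead_coef p ^+ e * q.[x].
  by rewrite -hornerZ Er !hornerE px mulr0 add0r.
have Ewr : w *: r = (lead_coef p ^+ e * (a * v) ^+ N)%:P.
  apply/eqP; rewrite -subr_eq0; apply/eqP/min_p.
  - rewrite rpredB ?polyOverZ ?polyOverC //.
    by apply: rpredM; apply: rpredX.
  - rewrite (leq_ltn_trans (size_polyD _ _)) // gtn_max size_polyN.
    rewrite (leq_ltn_trans (size_scale_leq _ _)) //=.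
    rewrite (leq_ltn_trans (size_polyC_leq1 _)) // ltnNge; apply/negP => p1.
    by move: px; rewrite (size1_polyC p1) hornerC => pc; move: p0; rewrite (size1_polyC p1) pc eqxx.
  rewrite !hornerE Erx -Eq exprMn -Eu.
  by rewrite mulrCA !mulrA subrr.
exists (maxn e N), (r`_0 * (lead_coef p ^+ (maxn e N - e) * (a * v) ^+ (maxn e N - N))).
  by apply: rpredM; [apply/polyOverP | apply: rpredM; apply: rpredX].
have Ew0 : w * r`_0 = lead_coef p ^+ e * (a * v) ^+ N by rewrite -coefZ Ewr coefC eqxx.
rewrite [w * _]mulrA Ew0 mulrACA -!exprD.
by rewrite !subnKC ?leq_maxl ?leq_maxr // -exprMn.
Qed.

Lemma unit_descent_adjoin S x a : a \in adjoin S x -> a != 0 ->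
  exists d, [/\ d \in S, d != 0 & unit_descent S (adjoin S x) a d].
Proof.
have [/unit_descent_algebraic|/unit_descent_transcendental] := pselect (algebraic S x); exact.
Qed.

Fixpoint adjoin_seq S (xs : seq L) : subringClosed L :=
  if xs is x :: xs' then GRing.SubringClosed.clone _ (adjoin (adjoin_seq S xs') x) _
  else S.

Lemma sub_adjoin_seq S xs y : y \in S -> y \in adjoin_seq S xs.
Proof. by move=> Sy; elim: xs => //= x xs IH; apply: sub_adjoin. Qed.

Lemma mem_adjoin_seq S xs x : x \in xs -> x \in adjoin_seq S xs.
Proof.
elim: xs => //= y xs IH; rewrite inE => /predU1P[->|/IH]; first exact: mem_adjoin.
exact: sub_adjoin.
Qed.

Lemma unit_descent_adjoin_seq S xs a : a \in adjoin_seq S xs -> a != 0 ->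
  exists d, [/\ d \in S, d != 0 & unit_descent S (adjoin_seq S xs) a d].
Proof.
elim: xs a => [|x xs IH] a Aa a0; first by exists a; split=> // w _.
have [b [Ab b0 Db]] := @unit_descent_adjoin (adjoin_seq S xs) x a Aa a0.
have [d [Sd d0 Dd]] := IH b Ab b0.
exists d; split=> // w Sw u; apply/Dd/Db=> //; exact: sub_adjoin_seq.
Qed.

End Adjunction.

Section Zariski.
Variables (k L : fieldType) (K : {rmorphism k -> L}).

Definition poly_values (t : L) : {pred L} :=
  fun y => `[< exists h : {poly k}, y = (map_poly K h).[t] >].

Lemma poly_valuesP t y :
  reflect (exists h : {poly k}, y = (map_poly K h).[t]) (y \in poly_values t).
Proof. exact: asboolP. Qed.

Lemma poly_values_subring t : subring_closed (poly_values t).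
Proof.
split=> [|_ _ /poly_valuesP[p ->] /poly_valuesP[q ->]|_ _ /poly_valuesP[p ->] /poly_valuesP[q ->]].
- by apply/poly_valuesP; exists 1; rewrite rmorph1 hornerC.
- by apply/poly_valuesP; exists (p - q); rewrite rmorphB hornerD hornerN.
- by apply/poly_valuesP; exists (p * q); rewrite rmorphM hornerM.
Qed.

HB.instance Definition _ t :=
  GRing.isSubringClosed.Build L (poly_values t) (poly_values_subring t).

(** Zariski's lemma.  If [t] were transcendental, all nonzero elements of [k[t]], being
    invertible in [L], would divide powers of a fixed [d != 0] in [k[t]].  The element
    [1 + d t] is prime to [d] and not a constant, so it does not. *)
Lemma finitely_generated_field_algebraic (xs : seq L) :
    (forall (S : subringClosed L), (forall c, K c \in S) ->
      forall y, y \in adjoin_seq S xs) ->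
  forall t, exists2 h : {poly k}, h != 0 & (map_poly K h).[t] = 0.
Proof.
move=> gen t; have [//|Nh] := pselect (exists2 h : {poly k}, h != 0 & (map_poly K h).[t] = 0).
have inj (h : {poly k}) : (map_poly K h).[t] = 0 -> h = 0.
  by move=> ht; apply/eqP/negP => /negP h0; apply: Nh; exists h.
have {}gen y : y \in adjoin_seq (poly_values t) xs.
  by apply: gen => c; apply/poly_valuesP; exists c%:P; rewrite map_polyC hornerC.
have [_ [/poly_valuesP[d ->] dt0 Dd]] := unit_descent_adjoin_seq (gen 1) (oner_neq0 _).
have d0 : d != 0 by apply: contraNneq dt0 => ->; rewrite rmorph0 horner0.
pose w := 1 + d * 'X.
have szw : size w = (size d).+1.
  rewrite /w addrC size_polyDl size_mulX // size_poly1 ltnS size_poly_gt0 //.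
have w0 : w != 0 by rewrite -size_poly_gt0 szw.
have wt0 : (map_poly K w).[t] != 0 by apply: contraNneq w0 => /inj->.
have Sw : (map_poly K w).[t] \in poly_values t by apply/poly_valuesP; exists w.
have [|N [_ /poly_valuesP[v ->] Ev]] := Dd _ Sw.
  by exists 0%N, (map_poly K w).[t]^-1; rewrite // divff.
have {}Ev : w * v = d ^+ N.
  apply/eqP; rewrite -subr_eq0; apply/eqP/inj.
  by rewrite rmorphB rmorphM rmorphXn hornerD hornerN hornerM horner_exp Ev subrr.
have cop : coprimep w (d ^+ N).
  apply: coprimep_expr; apply/Bezout_eq1_coprimepP; exists (1, - 'X) => /=.
  by rewrite mul1r /w mulNr ['X * d]mulrC addrK.
have : coprimep w w by apply: coprimep_dvdl cop; rewrite -Ev dvdp_mulr.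
by rewrite coprimepp szw eqSS size_poly_eq0 (negPf d0).
Qed.

End Zariski.

(** * Isolated zeros and univariate polynomials in the ideal *)
Section MaximalIdeals.
Variable R : comNzRingType.
Implicit Types (I J S : {pred R}).

(** The unit ideal is allowed here, which is what distinguishes this from
    [idealr_closed]. *)
Definition ideal I := 0 \in I /\ forall a, {in I &, forall u v, a * u + v \in I}.
Definition avoids S I := forall x, x \in S -> x \notin I.

Lemma exists_maximal_avoiding S I : ideal I -> avoids S I ->
  exists J, [/\ ideal J, avoids S J, {subset I <= J} &
    forall J', ideal J' -> avoids S J' -> {subset J <= J'} -> {subset J' <= J}].
Proof.
move=> idI avI.
pose good (J : {pred R}) := [/\ ideal J, avoids S J & {subset I <= J}].
pose T := {J : {pred R} | good J}.
have goodI : good I by split.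
pose le (A B : T) := `[< {subset sval A <= sval B} >].
have [||C totC|[J [idJ avJ subJ]] maxJ] := @classical_sets.ZL_preorder T (exist _ I goodI) le.
- by move=> A; apply/asboolP => x.
- by move=> A B C /asboolP AB /asboolP BC; apply/asboolP => x /AB /BC.
- have [[A0 CA0]|noC] := pselect (exists A, C A); last first.
    by exists (exist _ I goodI) => A CA; case: noC; exists A.
  pose U : {pred R} := fun x => `[< exists2 A : T, C A & x \in sval A >].
  have inU x : reflect (exists2 A : T, C A & x \in sval A) (x \in U) by exact: asboolP.
  have goodU : good U.
    split; first split.
    + by apply/inU; exists A0 => //; case: (svalP A0) => -[].
    + move=> a u v /inU[A CA Au] /inU[B CB Bv]; apply/inU.
      have [/asboolP AB|/asboolP BA] := totC _ _ CA CB.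
        by exists B => //; case: (svalP B) => -[_ idB] _ _; apply: idB => //; apply: AB.
      by exists A => //; case: (svalP A) => -[_ idA] _ _; apply: idA => //; apply: BA.
    + move=> x Sx; apply/negP => /inU[A _]; apply/negP.
      by case: (svalP A) => _ avA _; apply: avA.
    + by move=> x Ix; apply/inU; exists A0 => //; case: (svalP A0) => _ _; apply.
  by exists (exist _ U goodU) => A CA; apply/asboolP => x Ax; apply/inU; exists A.
exists J; split=> // J' idJ' avJ' JJ'.
have goodJ' : good J' by split=> // x /subJ/JJ'.
have := maxJ (exist _ J' goodJ'); rewrite /le /= => maxJ'.
by apply/asboolP/maxJ'/asboolP.
Qed.

Definition ideal_add J u : {pred R} := fun x => `[< exists j a, j \in J /\ x = j + a * u >].

Lemma ideal_addP J u x :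
  reflect (exists j a, j \in J /\ x = j + a * u) (x \in ideal_add J u).
Proof. exact: asboolP. Qed.

Lemma ideal_add_ideal J u : ideal J -> ideal (ideal_add J u).
Proof.
move=> [J0 JD]; split.
  by apply/ideal_addP; exists 0, 0; rewrite mul0r addr0.
move=> a _ _ /ideal_addP[j [b [Jj ->]]] /ideal_addP[j' [c [Jj' ->]]].
apply/ideal_addP; exists (a * j + j'), (a * b + c); split; first exact: JD.
by rewrite mulrDr mulrDl addrACA mulrA.
Qed.

Lemma sub_ideal_add J u : {subset J <= ideal_add J u}.
Proof. by move=> x Jx; apply/ideal_addP; exists x, 0; rewrite mul0r addr0. Qed.

Lemma mem_ideal_add J u : ideal J -> u \in ideal_add J u.
Proof. by case=> J0 _; apply/ideal_addP; exists 0, 1; rewrite mul1r add0r. Qed.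

Section Maximal.
Variables (S J : {pred R}).
Hypothesis idJ : ideal J.
Hypothesis maxJ : forall J', ideal J' -> avoids S J' -> {subset J <= J'} -> {subset J' <= J}.

Lemma maximal_avoiding_meets u : u \notin J -> exists j a, j \in J /\ j + a * u \in S.
Proof.
move=> Ju; case: (pselect (avoids S (ideal_add J u))) => [av|nav].
  case/negP: Ju; apply: (maxJ _ av); first exact: ideal_add_ideal.
    exact: sub_ideal_add.
  exact: mem_ideal_add.
apply: contrapT => no; apply: nav => x Sx; apply/negP => /ideal_addP[j [a [Jj Ex]]].
by apply: no; exists j, a; rewrite -Ex.
Qed.

(** If [u] and [v] are outside [J], both [J + (u)] and [J + (v)] meet [S], hence so does
    their product, which is contained in [J + (u * v)]. *)
Lemma maximal_avoiding_prime : avoids S J ->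
  (forall u v, u \in S -> v \in S -> u * v \in S) -> prime_idealr_closed J.
Proof.
move=> avJ SM u v Juv; apply: contraT.
rewrite negb_or => /andP[/maximal_avoiding_meets[j [a [Jj Su]]]].
move=> /maximal_avoiding_meets[j' [b [Jj' Sv]]].
rewrite -(negPf (avJ _ (SM _ _ Su Sv))).
case: idJ => J0 JD.
have -> : (j + a * u) * (j' + b * v) = (j' + b * v) * j + ((a * u) * j' + ((a * b) * (u * v) + 0)).
  by rewrite addr0 mulrDl [j * _]mulrC [a * u * (_ + _)]mulrDr [a * u * (b * v)]mulrACA.
by apply: (JD _ _ _ Jj); apply: (JD _ _ _ Jj'); apply: JD.
Qed.

End Maximal.

Lemma residue_field (J : {pred R}) : idealr_closed J ->
    (forall x, x \notin J -> exists y, 1 - y * x \in J) ->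
  exists (L : fieldType) (phi : {rmorphism R -> L}),
    (forall y, exists x, phi x = y) /\ (forall x, (phi x == 0) = (x \in J)).
Proof.
move=> idJ invJ.
pose J' : idealr R := HB.pack J (isIdealr.Build R J idJ).
pose Q : comNzRingType := {ideal_quot J'}.
pose pi : {rmorphism R -> Q} := \pi_Q.
have piE x : (pi x == 0) = (x \in J).
  by rewrite -[x in RHS]subr0 (Quotient.idealrBE J') !piE.
have invP (x : Q) : {y | (x = 0 -> y = 0) /\ (x != 0 -> y * x = 1)}.
  apply: cid; have [->|x0] := eqVneq x 0; first by exists 0.
  have [|y Jy] := invJ (repr x).
    by rewrite -piE /= reprK.
  exists (pi y); split=> [Ex|_]; first by case/eqP: x0.
  apply/esym/eqP; rewrite -subr_eq0 -[x]reprK -rmorphM -(rmorph1 pi) -rmorphB.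
  by rewrite piE.
pose inv (x : Q) := sval (invP x).
have inv0 : inv 0 = 0 by rewrite /inv; case: (invP 0) => y [/= ->].
have mulVf x : x != 0 -> inv x * x = 1.
  by move=> x0; rewrite /inv; case: (invP x) => y [/= _ ->].
pose L : fieldType := HB.pack (GRing.ComNzRing.sort Q) (GRing.ComNzRing_isField.Build Q mulVf inv0).
exists L, pi; split=> // y; exists (repr y); exact: reprK.
Qed.

End MaximalIdeals.

Section Elimination.
Variables (k : fieldType) (n : nat).
Local Notation P := {mpoly k[n]}.

Definition univariate (i : 'I_n) (h : {poly k}) : P := (map_poly (@mpolyC n k) h).['X_i].

Lemma univariateM i h h' : univariate i (h * h') = univariate i h * univariate i h'.
Proof. by rewrite /univariate rmorphM hornerM. Qed.

Lemma univariate1 i : univariate i 1 = 1.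
Proof. by rewrite /univariate rmorph1 hornerC. Qed.

Lemma univariateE i h :
  univariate i h = \sum_(e < size h) h`_e *: 'X_i ^+ e.
Proof.
rewrite /univariate horner_coef size_map_poly; apply: eq_bigr => e _.
by rewrite coef_map mul_mpolyC.
Qed.

Lemma residue_field_algebraic (L : fieldType) (phi : {rmorphism P -> L}) :
    (forall y, exists p, phi p = y) ->
  forall i, exists2 h : {poly k}, h != 0 & phi (univariate i h) = 0.
Proof.
move=> surj i; pose K : {rmorphism k -> L} := phi \o @mpolyC n k.
have gen (S : subringClosed L) : (forall c, K c \in S) ->
    forall y, y \in adjoin_seq S [seq phi 'X_j | j <- enum 'I_n].
  move=> SK y; have [p <-] := surj y.
  rewrite [p]mpolyE rmorph_sum rpred_sum // => m _.
  rewrite -mul_mpolyC rmorphM rpredM //; first exact/sub_adjoin_seq/SK.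
  rewrite mpolyXE_id rmorph_prod rpred_prod // => j _; rewrite rmorphXn rpredX //.
  by apply: mem_adjoin_seq; apply: map_f; rewrite mem_enum.
have [h h0 Eh] := finitely_generated_field_algebraic gen (phi 'X_i).
by exists h => //; rewrite /univariate -horner_map -map_poly_comp.
Qed.

Lemma generated_ideal_ideal (f : 'I_n -> P) : ideal (generated_ideal f).
Proof.
split=> [|a u v Iu Iv]; first exact: rpred0.
by rewrite rpredD ?generated_idealM.
Qed.

Lemma mem_generated_ideal (f : 'I_n -> P) j : f j \in generated_ideal f.
Proof.
apply/generated_idealP; exists (fun l => (l == j)%:R).
by rewrite (bigD1 j) //= eqxx mul1r big1 ?addr0 // => l /negPf->; rewrite mul0r.
Qed.

(** See the introduction: the ideal [J] is maximal among those avoiding the nonzero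
    polynomials in [x_i], the ideal [M] is a maximal ideal above it, and isolation of
    the zero [M] identifies them. *)
Lemma isolated_zeros_univariate (f : 'I_n -> P) : only_isolated_zeros f ->
  forall i, exists2 h, h != 0 & univariate i h \in generated_ideal f.
Proof.
move=> isol i; apply: contrapT => no.
pose S : {pred P} := fun x => `[< exists2 h, h != 0 & x = univariate i h >].
have inS x : reflect (exists2 h, h != 0 & x = univariate i h) (x \in S) by exact: asboolP.
have SM u v : u \in S -> v \in S -> u * v \in S.
  move=> /inS[h h0 ->] /inS[h' h'0 ->]; apply/inS.
  by exists (h * h'); rewrite ?mulf_neq0 ?univariateM.
have S1 : 1 \in S by apply/inS; exists 1; rewrite ?oner_neq0 ?univariate1.
have avf : avoids S (generated_ideal f).
  by move=> _ /inS[h h0 ->]; apply/negP => fh; apply: no; exists h.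
have [J [idJ avJ fJ maxJ]] := exists_maximal_avoiding (generated_ideal_ideal f) avf.
have primeJ := maximal_avoiding_prime idJ maxJ avJ SM.
have idJ' : idealr_closed J by case: idJ => J0 JD; split=> //; apply: avJ.
have av1 : avoids (pred1 1) J by move=> _ /eqP->; apply: avJ.
have [M [idM avM JM maxM]] := exists_maximal_avoiding idJ av1.
have maxMJ : maximal_ideal M.
  split; first by case: idM => M0 MD; split=> //; apply: avM; rewrite inE.
  move=> I [I0 I1 ID] MI x; apply/idP/idP; last exact: MI.
  by apply: maxM => // _ /eqP->.
(* The neighbourhood of [M] given by isolation also contains the prime [J]. *)
have [|g Mg gJ] := isol M maxMJ; first by move=> j; apply/JM/fJ/mem_generated_ideal.
have JeM : J =i M.
  apply: gJ => //; first by move=> j; apply/fJ/mem_generated_ideal.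
  by apply: contra Mg; apply: JM.
have inv x : x \notin J -> exists y, 1 - y * x \in J.
  rewrite JeM => /(maximal_avoiding_meets idM maxM)[j [a [Mj /eqP E1]]].
  by exists a; rewrite JeM -E1 addrK.
have [L [phi [surj kerphi]]] := residue_field idJ' inv.
have [h h0 /eqP] := residue_field_algebraic surj i.
by rewrite kerphi; apply/negP/avJ/inS; exists h.
Qed.

End Elimination.

(** * Determinants modulo an ideal *)
Section Ideals.
Variables (R : comNzRingType) (I : {pred R}).
Hypothesis idI : ideal I.

Lemma idealD u v : u \in I -> v \in I -> u + v \in I.
Proof. by case: idI => _ ID Iu Iv; rewrite -[u]mul1r ID. Qed.

Lemma idealM a u : u \in I -> a * u \in I.
Proof. by case: idI => I0 ID Iu; rewrite -[_ * _]addr0 ID. Qed.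

Lemma idealB u v : u \in I -> v \in I -> u - v \in I.
Proof. by move=> Iu Iv; rewrite -mulN1r idealD ?idealM. Qed.

Lemma ideal_sum (T : Type) (r : seq T) (p : pred T) (F : T -> R) :
  (forall i, p i -> F i \in I) -> \sum_(i <- r | p i) F i \in I.
Proof. by move=> IF; apply: (big_ind (fun x => x \in I)) => //; [case: idI | exact: idealD]. Qed.

End Ideals.

Section RegularSequences.
Variables (R : comNzRingType) (n : nat) (z : 'I_n -> R).

Definition regular_sequence := forall (t : 'I_n) (x : R) (c : 'I_n -> R),
  x * z t = \sum_(i < n | (i < t)%N) c i * z i ->
  exists h : 'I_n -> R, x = \sum_(i < n | (i < t)%N) h i * z i.

(** Induction on the number [m] of entries of [r] that may be nonzero.  The last one is,
    by regularity, a combination of the earlier [z i]; subtracting the corresponding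
    Koszul syzygies makes it vanish. *)
Lemma koszul_syzygy (r : 'I_n -> R) : regular_sequence ->
    \sum_i r i * z i = 0 ->
  exists s : 'I_n -> 'I_n -> R, forall i, r i = \sum_j (s i j - s j i) * z j.
Proof.
move=> reg rz.
have : forall i : 'I_n, (n <= i)%N -> r i = 0 by move=> i; rewrite leqNgt ltn_ord.
(* Only the bound on the support of [r] is generalized, not the length of [z]. *)
move: (leqnn n); move: {1 4}n => m.
elim: m r rz => [|m IH] r rz le_m r0.
  by exists (fun _ _ => 0) => i; rewrite r0 // big1 // => j _; rewrite subrr mul0r.
pose t := Ordinal le_m.
have [|h Eh] := reg t (r t) (fun i => - r i).
  have := rz; rewrite (bigD1 t) //= => /eqP; rewrite addr_eq0 => /eqP->.
  rewrite -sumrN [RHS]big_mkcond [LHS]big_mkcond /=; apply: eq_bigr => i _.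
  rewrite mulNr -val_eqE /=; case: ltngtP => //= lt_i.
  by rewrite r0 // mul0r oppr0.
pose h' (i : 'I_n) := if (i < m)%N then h i else 0.
have {}Eh : r t = \sum_i h' i * z i.
  rewrite Eh [LHS]big_mkcond; apply: eq_bigr => i _ /=.
  by rewrite /h'; case: ifP; rewrite ?mul0r.
pose r' i := if i == t then 0 else r i + h' i * z t.
have [||i le_mi|s Es] := IH r'.
- rewrite (bigD1 t) //= /r' eqxx mul0r add0r.
  rewrite (eq_bigr (fun i => r i * z i + h' i * z i * z t)); last first.
    by move=> i /negPf->; rewrite mulrDl -!mulrA [z t * _]mulrC.
  rewrite big_split /= -mulr_suml.
  have := rz; rewrite (bigD1 t) //= => /eqP; rewrite addrC addr_eq0 => /eqP->.
  have := Eh; rewrite (bigD1 t) //= {1}/h' ltnn mul0r add0r => <-.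
  by rewrite addNr.
- exact: ltnW.
- rewrite /r'; case: eqVneq => // ne_it.
  have lt_mi : (m < i)%N by rewrite ltn_neqAle le_mi andbT eq_sym.
  by rewrite r0 // /h' ltnNge le_mi mul0r addr0.
exists (fun i j => s i j + (if i == t then h' j else 0)) => i.
have h't : h' t = 0 by rewrite /h' ltnn.
rewrite (eq_bigr (fun j => (s i j - s j i) * z j +
    ((if i == t then h' j else 0) * z j - (if j == t then h' i else 0) * z j))); last first.
  by move=> j _; rewrite -mulrBl -mulrDl opprD addrACA.
have Et : \sum_j (if j == t then h' i else 0) * z j = h' i * z t.
  by rewrite (bigD1 t) //= eqxx big1 ?addr0 // => j /negPf->; rewrite mul0r.
rewrite big_split /= -Es sumrB Et /r'; case: eqVneq => [->|_].
  by rewrite add0r h't mul0r subr0.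
by rewrite [X in _ + (X - _)]big1 ?sub0r ?addrK // => j _; rewrite mul0r.
Qed.

End RegularSequences.

Section Wiebe.
Variables (R : comNzRingType) (n : nat).

Lemma cofactor_eq_col (M M' : 'M[R]_n) (t : 'I_n) :
    (forall i j, j != t -> M i j = M' i j) ->
  forall i, cofactor M i t = cofactor M' i t.
Proof.
move=> eqM i; congr (_ * \det _); apply/matrixP=> a b.
by rewrite !mxE eqM // eq_sym neq_lift.
Qed.

Variables (z : 'I_n -> R) (I : {pred R}).
Hypothesis idI : ideal I.

Definition set_col (M : 'M[R]_n) t (v : 'I_n -> R) : 'M[R]_n :=
  \matrix_(i, j) if j == t then v i else M i j.

Lemma det_set_col M t v : \det (set_col M t v) = \sum_i v i * cofactor M i t.
Proof.
rewrite (expand_det_col _ t); apply: eq_bigr => i _; rewrite mxE eqxx; congr (_ * _).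
by apply: cofactor_eq_col => a b /negPf nb; rewrite mxE nb.
Qed.

(** Give [M] the unit vector at [p] as its column [t].  Its determinant is the cofactor
    at [p], its row [t] of cofactors is that of [M], and [z] times the matrix is zero
    modulo [I] outside column [t]; the claim is the entry [q] of the identity
    [z *m B *m \adj B = \det B *: z]. *)
Lemma cofactor_koszul (M : 'M[R]_n) (t p q : 'I_n) :
    (forall j, j != t -> \sum_i M i j * z i \in I) ->
  z q * cofactor M p t - z p * cofactor M q t \in I.
Proof.
move=> IM; pose B := set_col M t (fun i => (i == p)%:R).
have detB : \det B = cofactor M p t.
  rewrite det_set_col (bigD1 p) //= eqxx mul1r big1 ?addr0 // => i /negPf->.
  by rewrite mul0r.
pose zr : 'rV[R]_n := \row_i z i.
have := mulmxA zr B (\adj B); rewrite mul_mx_adj => /matrixP/(_ 0 q).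
rewrite mul_mx_scalar mxE detB mxE mulrC => ->.
rewrite mxE (bigD1 t) //= !mxE (bigD1 p) //= !mxE !eqxx mulr1 big1 ?addr0; last first.
  by move=> i /negPf np; rewrite !mxE eqxx np mulr0.
rewrite (@cofactor_eq_col B M t); last by move=> a b /negPf nb; rewrite mxE nb.
rewrite addrAC subrr add0r; apply: ideal_sum => // j nj.
rewrite mulrC; apply: idealM => //; rewrite mxE.
rewrite (eq_bigr (fun i => M i j * z i)) ?IM // => i _.
by rewrite !mxE (negPf nj) mulrC.
Qed.

(** The matrices are exchanged column by column.  The two columns exchanged differ by
    a syzygy of [z], which is a combination of Koszul syzygies; expanding along this
    column gives the expressions of [cofactor_koszul]. *)
Lemma det_congruence (F : 'I_n -> R) (A A' : 'M[R]_n) :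
    regular_sequence z -> (forall j, F j \in I) ->
    (forall j, \sum_i A i j * z i = F j) -> (forall j, \sum_i A' i j * z i = F j) ->
  \det A - \det A' \in I.
Proof.
move=> reg IF EA EA'.
pose mix m : 'M[R]_n := \matrix_(i, j) if (j < m)%N then A i j else A' i j.
have Emix m j : \sum_i mix m i j * z i = F j.
  by case: (ltnP j m) => h; [rewrite -EA | rewrite -EA']; apply: eq_bigr => i _;
     rewrite mxE; [rewrite h | rewrite ltnNge h].
have mix0 : mix 0%N = A' by apply/matrixP => i j; rewrite mxE.
have mixn : mix n = A by apply/matrixP => i j; rewrite mxE ltn_ord.
suff H m : (m <= n)%N -> \det (mix m) - \det A' \in I by rewrite -mixn H.
elim: m => [|m IH] lt_m; first by rewrite mix0 subrr; case: idI.
rewrite -(subrK (\det (mix m)) (\det (mix m.+1))) -addrA.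
apply: (idealD idI); last exact/IH/ltnW.
pose t := Ordinal lt_m.
have Cmix i : cofactor (mix m.+1) i t = cofactor (mix m) i t.
  apply: cofactor_eq_col => a b nb.
  by rewrite !mxE ltnS leq_eqVlt -[b == m :> nat]/(b == t) (negPf nb).
rewrite (expand_det_col (mix m.+1) t) (expand_det_col (mix m) t) -sumrB.
have [|s Es] := @koszul_syzygy _ _ z (fun i => A i t - A' i t) reg.
  by under eq_bigr do rewrite mulrBl; rewrite sumrB EA EA' subrr.
rewrite (eq_bigr (fun i => \sum_j (s i j * (z j * cofactor (mix m) i t)
     - s j i * (z j * cofactor (mix m) i t)))); last first.
  move=> i _; rewrite Cmix !mxE ltnSn ltnn -mulrBl Es mulr_suml.
  by apply: eq_bigr => j _; rewrite -mulrA mulrBl.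
under eq_bigr do rewrite sumrB.
rewrite sumrB [X in _ - X]exchange_big /= -sumrB; apply: ideal_sum => // i _.
rewrite -sumrB; apply: ideal_sum => // j _; rewrite -mulrBr.
apply: idealM => //; apply: cofactor_koszul => l _; by rewrite Emix.
Qed.

End Wiebe.

(** * The polynomial ring in two sets of variables *)
Section MorphismCongruence.
Variables (k : fieldType) (n : nat) (R : comNzRingType) (J : {pred R}).
Hypothesis idJ : ideal J.

Lemma morphism_congruence (phi psi : {rmorphism {mpoly k[n]} -> R}) :
    (forall c, phi c%:MP = psi c%:MP) -> (forall i, phi 'X_i - psi 'X_i \in J) ->
  forall p, phi p - psi p \in J.
Proof.
move=> eqC JX; have J0 : 0 \in J by case: idJ.
have JM p q : phi p - psi p \in J -> phi q - psi q \in J -> phi (p * q) - psi (p * q) \in J.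
  move=> Jp Jq.
  have -> : phi (p * q) - psi (p * q) =
            phi p * (phi q - psi q) + psi q * (phi p - psi p).
    by rewrite !rmorphM !mulrBr [psi q * phi p]mulrC [psi q * psi p]mulrC addrA subrK.
  by apply: idealD => //; apply: idealM.
elim/mpolyind => [|c m p _ _ IH]; first by rewrite !raddf0 addr0.
rewrite (raddfD phi) (raddfD psi) opprD addrACA; apply: idealD => //.
rewrite -mul_mpolyC; apply/JM => //; first by rewrite eqC subrr.
rewrite mpolyXE_id; apply: (big_ind (fun q => phi q - psi q \in J)).
- by rewrite !rmorph1 subrr.
- by move=> p1 p2; apply/JM.
move=> i _; elim: (m i : nat) => [|e IHe]; first by rewrite !rmorph1 subrr.
by rewrite exprS; apply/JM.
Qed.

End MorphismCongruence.

Section Span.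
Variables (R : comNzRingType) (n : nat) (z : 'I_n -> R).

Definition span_ideal : {pred R} :=
  fun x => `[< exists h : 'I_n -> R, x = \sum_i h i * z i >].

Lemma span_idealP x :
  reflect (exists h : 'I_n -> R, x = \sum_i h i * z i) (x \in span_ideal).
Proof. exact: asboolP. Qed.

Lemma span_ideal_ideal : ideal span_ideal.
Proof.
split; first by apply/span_idealP; exists (fun=> 0); rewrite big1 // => i _; rewrite mul0r.
move=> a _ _ /span_idealP[h ->] /span_idealP[h' ->]; apply/span_idealP.
exists (fun i => a * h i + h' i); rewrite mulr_sumr -big_split /=.
by apply: eq_bigr => i _; rewrite mulrDl mulrA.
Qed.

Lemma mem_span_ideal i : z i \in span_ideal.
Proof.
apply/span_idealP; exists (fun j => (j == i)%:R).
by rewrite (bigD1 i) //= eqxx mul1r big1 ?addr0 // => j /negPf->; rewrite mul0r.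
Qed.

End Span.

Lemma morphism_eq (k : fieldType) n (R : comPzRingType)
    (phi psi : {rmorphism {mpoly k[n]} -> R}) :
    (forall c, phi c%:MP = psi c%:MP) -> (forall i, phi 'X_i = psi 'X_i) -> phi =1 psi.
Proof.
move=> eqC eqX p; elim/mpolyind: p => [|c m p _ _ IH]; first by rewrite !rmorph0.
rewrite !rmorphD IH -mul_mpolyC !rmorphM eqC mpolyXE_id !rmorph_prod.
by congr (_ * _ + _); apply: eq_bigr => i _; rewrite !rmorphXn eqX.
Qed.

Section TwoSets.
Variables (k : fieldType) (n : nat).
Local Notation P := {mpoly k[n]}.
Local Notation R2 := {mpoly k[n + n]}.

Definition diffXY (i : 'I_n) : R2 := bigX k i - bigY k i.

Lemma comp_mpoly_var m (u : n.-tuple {mpoly k[m]}) i : ('X_i : P) \mPo u = tnth u i.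
Proof. by rewrite comp_mpolyXU -tnth_nth. Qed.

Lemma comp_mpoly_diff m (p : P) (u v : n.-tuple {mpoly k[m]}) :
  exists h : 'I_n -> {mpoly k[m]}, (p \mPo u) - (p \mPo v) = \sum_i h i * (tnth u i - tnth v i).
Proof.
apply/span_idealP.
apply: (morphism_congruence (span_ideal_ideal _) (phi := comp_mpoly u) (psi := comp_mpoly v)).
  by move=> c; rewrite /= !comp_mpolyC.
by move=> i; rewrite /= !comp_mpoly_var; apply: mem_span_ideal.
Qed.

Lemma diffXY_neq0 i : diffXY i != 0.
Proof.
apply/negP => /eqP/(congr1 (mcoeff U_(lshift n i))).
rewrite mcoeffB mcoeff0 /bigX /bigY !mcoeffX eqxx eq_mnm1 -val_eqE /=.
by rewrite eqn_leq leqNgt (leq_trans (ltn_ord i)) ?leq_addr // subr0 => /eqP; rewrite oner_eq0.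
Qed.

(** The substitution [sigma] of [Y_i] for [X_i], [i < t], is congruent to the identity
    modulo the first [t] differences, kills these and fixes [X_t - Y_t].  So it turns
    the relation into [sigma x * (X_t - Y_t) = 0] in a domain, and
    [x = x - sigma x]. *)
Lemma diffXY_regular : regular_sequence diffXY.
Proof.
move=> t x c Exz.
pose im (l : 'I_(n + n)) : R2 := match split l with
  | inl i => if (i < t)%N then bigY k i else bigX k i | inr i => bigY k i end.
pose sigma : {rmorphism R2 -> R2} := comp_mpoly [tuple im l | l < n + n].
have sX i : sigma (bigX k i) = if (i < t)%N then bigY k i else bigX k i.
  by rewrite /= comp_mpolyXU -tnth_nth tnth_mktuple /im -[lshift n i]/(unsplit (inl i)) unsplitK.
have sY i : sigma (bigY k i) = bigY k i.
  by rewrite /= comp_mpolyXU -tnth_nth tnth_mktuple /im -[rshift n i]/(unsplit (inr i)) unsplitK.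
have sz i : sigma (diffXY i) = if (i < t)%N then 0 else diffXY i.
  by rewrite rmorphB sX sY; case: ifP; rewrite ?subrr.
have sx0 : sigma x = 0.
  have /(congr1 sigma)/eqP := Exz; rewrite rmorphM sz ltnn rmorph_sum big1; last first.
    by move=> i lt_i; rewrite rmorphM sz lt_i mulr0.
  by rewrite mulf_eq0 (negPf (diffXY_neq0 t)) orbF => /eqP.
pose z' (i : 'I_n) := if (i < t)%N then diffXY i else 0.
have : x - sigma x \in span_ideal z'.
  apply: (morphism_congruence (span_ideal_ideal z') (phi := idfun) (psi := sigma)).
    by move=> a; rewrite /= comp_mpolyC.
  move=> l; rewrite -[l]splitK; case: (split l) => i /=.
    rewrite -[comp_mpoly _ _]/(sigma (bigX k i)) sX -/(bigX k i).
    case: ifP => lt_i; last by rewrite subrr; case: (span_ideal_ideal z').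
    by have := mem_span_ideal z' i; rewrite /z' lt_i.
  rewrite -[comp_mpoly _ _]/(sigma (bigY k i)) sY subrr.
  by case: (span_ideal_ideal z').
rewrite sx0 subr0 => /span_idealP[h ->]; exists h; rewrite [RHS]big_mkcond.
by apply: eq_bigr => i _; rewrite /z' /=; case: ifP; rewrite ?mulr0.
Qed.

Definition inX (p : P) : R2 := p \mPo [tuple bigX k i | i < n].
Definition inY (p : P) : R2 := p \mPo [tuple bigY k i | i < n].
HB.instance Definition _ := GRing.RMorphism.copy inX (comp_mpoly [tuple bigX k i | i < n]).
HB.instance Definition _ := GRing.RMorphism.copy inY (comp_mpoly [tuple bigY k i | i < n]).

Lemma inX_var i : inX 'X_i = bigX k i.
Proof. by rewrite /inX comp_mpoly_var tnth_mktuple. Qed.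
Lemma inY_var i : inY 'X_i = bigY k i.
Proof. by rewrite /inY comp_mpoly_var tnth_mktuple. Qed.
Lemma inXC c : inX c%:MP = c%:MP. Proof. exact: comp_mpolyC. Qed.
Lemma inYC c : inY c%:MP = c%:MP. Proof. exact: comp_mpolyC. Qed.

Lemma inX_subst p : subst_YX 0 p = inX p.
Proof. by congr (_ \mPo _). Qed.

Lemma inY_subst p : subst_YX n p = inY p.
Proof.
congr (_ \mPo _); apply: eq_from_tnth => i.
by rewrite !tnth_mktuple ltn_ord.
Qed.

End TwoSets.

(** * Evaluation in a tensor square *)
Section TensorMorphisms.
Variables (k : fieldType) (A B : comAlgType k).
Local Notation T := (tensor A B).

Lemma tensM (a a' : A) (b b' : B) : (a ⊗ b) * (a' ⊗ b') = (a * a') ⊗ (b * b') :> T.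
Proof. exact: tensor_mul_tens. Qed.

Lemma tens0l (b : B) : (0 : A) ⊗ b = 0 :> T.
Proof. by rewrite -[X in X ⊗ b](scale0r (0 : A)) tensZl scale0r. Qed.
Lemma tens0r (a : A) : a ⊗ (0 : B) = 0 :> T.
Proof. by rewrite -[X in a ⊗ X](scale0r (0 : B)) tensZr scale0r. Qed.

Definition tensl (a : A) : T := a ⊗ 1.
Definition tensr (b : B) : T := 1 ⊗ b.

Lemma tensl_nmod : nmod_morphism tensl.
Proof. by split=> [|p q]; [exact: tens0l | exact: tensDl]. Qed.
Lemma tensr_nmod : nmod_morphism tensr.
Proof. by split=> [|p q]; [exact: tens0r | exact: tensDr]. Qed.
HB.instance Definition _ := GRing.isNmodMorphism.Build A T tensl tensl_nmod.
HB.instance Definition _ := GRing.isNmodMorphism.Build B T tensr tensr_nmod.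

Lemma tensl_monoid : monoid_morphism tensl.
Proof. by split=> // p q; rewrite /tensl tensM mulr1. Qed.
Lemma tensr_monoid : monoid_morphism tensr.
Proof. by split=> // p q; rewrite /tensr tensM mulr1. Qed.
HB.instance Definition _ := GRing.isMonoidMorphism.Build A T tensl tensl_monoid.
HB.instance Definition _ := GRing.isMonoidMorphism.Build B T tensr tensr_monoid.

Lemma tens_lr a b : a ⊗ b = tensl a * tensr b.
Proof. by rewrite tensM mulr1 mul1r. Qed.

Lemma tensor_scaleE c (t : T) : c *: t = tensl (c *: 1) * t.
Proof.
elim/tensor_ind: t => [|d p q t IH]; first by rewrite scaler0 mulr0.
rewrite scalerDr mulrDr IH; congr (_ + _).
by rewrite -!tensZl tensM mul1r -scalerAl mul1r.
Qed.

Lemma tensr_scale c : tensr (c *: 1) = tensl (c *: 1).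
Proof. by rewrite /tensr /tensl tensZl tensZr. Qed.

Section Morphism.
Variables (R : comAlgType k) (phi : {lrmorphism A -> R}) (psi : {lrmorphism B -> R}).

Definition tensor_morphism (t : T) : R := tensor_lift (fun a b => phi a * psi b) t.

Let morph_l b : linear (fun a => phi a * psi b).
Proof. by move=> c x y; rewrite linearP mulrDl scalerAl. Qed.
Let morph_r a : linear (fun b => phi a * psi b).
Proof. by move=> c x y; rewrite linearP mulrDr scalerAr. Qed.

Lemma tensor_morphism_linear : linear tensor_morphism.
Proof. exact: (tensor_lift_linear (beta := fun a b => phi a * psi b) morph_l morph_r). Qed.
HB.instance Definition _ := GRing.isLinear.Build k T R _ tensor_morphism tensor_morphism_linear.

Lemma tensor_morphism_tens a b : tensor_morphism (a ⊗ b) = phi a * psi b.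
Proof. exact: (tensor_lift_tens (beta := fun a b => phi a * psi b) morph_l morph_r). Qed.

Lemma tensor_morphismM : {morph tensor_morphism : s t / s * t}.
Proof.
move=> s t; elim/tensor_ind: s => [|c p q s IH]; first by rewrite mul0r linear0 mul0r.
rewrite mulrDl !linearD /= mulrDl IH; congr (_ + _).
rewrite -tensZl.
elim/tensor_ind: t {IH} => [|d p' q' t IH]; first by rewrite mulr0 linear0 mulr0.
rewrite mulrDr !linearD /= mulrDr IH; congr (_ + _).
by rewrite -tensZl tensM !tensor_morphism_tens !rmorphM mulrACA.
Qed.

Lemma tensor_morphism_monoid : monoid_morphism tensor_morphism.
Proof.
split; last exact: tensor_morphismM.
by rewrite tensor_morphism_tens !rmorph1 mulr1.
Qed.
HB.instance Definition _ :=
  GRing.isMonoidMorphism.Build T R tensor_morphism tensor_morphism_monoid.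
End Morphism.
End TensorMorphisms.
Arguments tensl {k A B} a.
Arguments tensr {k A B} b.

Section Evaluation.
Variables (k : fieldType) (m : nat) (T : comPzRingType).
Variables (c : {rmorphism k -> T}) (v : 'I_m -> T).

(** Evaluation at a point of a ring that may be zero: [mmap] asks for a nonzero target,
    and in the zero ring all the equations hold. *)
Definition mpoly_eval (h : {mpoly k[m]}) : T :=
  \sum_(e <- msupp h) c h@_e * \prod_(i < m) v i ^+ e i.

Lemma mpoly_eval_morphism :
  [/\ nmod_morphism mpoly_eval, monoid_morphism mpoly_eval,
      forall a, mpoly_eval a%:MP = c a & forall i, mpoly_eval 'X_i = v i].
Proof.
have [T0|T1] := eqVneq (1 : T) 0.
  have all0 (x : T) : x = 0 by rewrite -[x]mul1r T0 mul0r.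
  have all_eq (x y : T) : x = y by rewrite [x]all0 [y]all0.
  by split; [split=> [|p q]|split=> [|p q]|move=> a|move=> i]; apply: all_eq.
pose T' : comNzRingType := HB.pack (GRing.ComPzRing.sort T) (GRing.PzSemiRing_isNonZero.Build T T1).
pose c' : {rmorphism k -> T'} := c.
pose F : {rmorphism {mpoly k[m]} -> T'} := mmap c' (v : 'I_m -> T').
rewrite (_ : mpoly_eval = F) //; split.
- by split; [exact: rmorph0 | exact: rmorphD].
- by split; [exact: rmorph1 | exact: rmorphM].
- by move=> a; exact: (mmapC _ c').
- by move=> i; rewrite /F /= mmapX mmap1U.
Qed.

End Evaluation.

Section TensorEvaluation.
Variables (k : fieldType) (A B : comAlgType k) (m : nat) (v : 'I_m -> tensor A B).
Local Notation T := (tensor A B).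

Definition tensor_eval (h : {mpoly k[m]}) : T :=
  \sum_(e <- msupp h) h@_e *: \prod_(i < m) v i ^+ e i.

Let scal : {rmorphism k -> T} := @tensl k A B \o in_alg A.

Let tensor_evalE : tensor_eval = mpoly_eval scal v.
Proof. by apply: funext => h; apply: eq_bigr => e _; rewrite tensor_scaleE. Qed.

Let tensor_eval_all := mpoly_eval_morphism scal v.

Lemma tensor_eval_nmod : nmod_morphism tensor_eval.
Proof. by rewrite tensor_evalE; case: tensor_eval_all. Qed.
Lemma tensor_eval_monoid : monoid_morphism tensor_eval.
Proof. by rewrite tensor_evalE; case: tensor_eval_all. Qed.
HB.instance Definition _ :=
  GRing.isNmodMorphism.Build {mpoly k[m]} T tensor_eval tensor_eval_nmod.
HB.instance Definition _ :=
  GRing.isMonoidMorphism.Build {mpoly k[m]} T tensor_eval tensor_eval_monoid.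

Lemma tensor_evalC c : tensor_eval c%:MP = tensl (c *: 1).
Proof. by rewrite tensor_evalE; case: tensor_eval_all. Qed.

Lemma tensor_evalX i : tensor_eval 'X_i = v i.
Proof. by rewrite tensor_evalE; case: tensor_eval_all. Qed.

End TensorEvaluation.

(** The polynomial algebra enters only through an algebra [A] with elements [x_i] and two
    embeddings [iX], [iY] into [k[X, Y]] that are sections of the evaluation
    [X_i |-> x_i ⊗ 1], [Y_i |-> 1 ⊗ x_i]. *)
Section Doubling.
Variables (k : fieldType) (n : nat) (A : comAlgType k) (x : 'I_n -> A).
Local Notation T := (tensor A A).
Local Notation R2 := {mpoly k[n + n]}.

Definition double_var (i : 'I_(n + n)) : T :=
  match split i with inl j => x j ⊗ 1 | inr j => 1 ⊗ x j end.

Local Notation E := (tensor_eval double_var).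

Lemma eval_bigX i : E (bigX k i) = tensl (x i).
Proof.
by rewrite tensor_evalX /double_var -[lshift n i]/(unsplit (inl i)) unsplitK.
Qed.

Lemma eval_bigY i : E (bigY k i) = tensr (x i).
Proof.
by rewrite tensor_evalX /double_var -[rshift n i]/(unsplit (inr i)) unsplitK.
Qed.

Variables (iX iY : {lrmorphism A -> R2}).
Hypothesis evalX : forall p, E (iX p) = tensl p.
Hypothesis evalY : forall p, E (iY p) = tensr p.

Local Notation coords := (tensor_morphism iX iY).

Lemma eval_coords (t : T) : E (coords t) = t.
Proof.
elim/tensor_ind: t => [|c p q t IH]; first by rewrite !rmorph0.
rewrite -tensZl !rmorphD /= IH; congr (_ + _).
by rewrite tensor_morphism_tens rmorphM /= evalX evalY -tens_lr.
Qed.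

Lemma coords_tensl p : coords (tensl p) = iX p.
Proof. by rewrite tensor_morphism_tens rmorph1 mulr1. Qed.
Lemma coords_tensr p : coords (tensr p) = iY p.
Proof. by rewrite tensor_morphism_tens rmorph1 mul1r. Qed.

Section Kernel.
Variables (V : lmodType k) (L : {linear T -> V}).

(** The largest ideal on which [L] vanishes after evaluation.  Working with ideals of
    this kind in [k[X, Y]], [det_congruence] can be used there although [L] itself is
    merely linear. *)
Definition eval_kernel : {pred R2} := fun h => `[< forall s, L (E (s * h)) = 0 >].

Lemma eval_kernelP h : reflect (forall s, L (E (s * h)) = 0) (h \in eval_kernel).
Proof. exact: asboolP. Qed.

Lemma eval_kernel_ideal : ideal eval_kernel.
Proof.
split=> [|a u v /eval_kernelP Ju /eval_kernelP Jv]; apply/eval_kernelP => s.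
  by rewrite mulr0 rmorph0 linear0.
by rewrite mulrDr rmorphD linearD /= mulrA Ju Jv addr0.
Qed.

Lemma eval_kernel0 h : h \in eval_kernel -> L (E h) = 0.
Proof. by move=> /eval_kernelP/(_ 1); rewrite mul1r. Qed.

Lemma linear_kill_pure (s : T) : (forall p q, L ((p ⊗ q) * s) = 0) -> forall t, L (t * s) = 0.
Proof.
move=> Ls; elim/tensor_ind => [|c p q t IH]; first by rewrite mul0r linear0.
by rewrite mulrDl linearD /= -tensZl Ls IH addr0.
Qed.

Lemma eval_kernelX p : (forall q r, L ((q * p) ⊗ r) = 0) -> iX p \in eval_kernel.
Proof.
move=> Lp; apply/eval_kernelP => s; rewrite rmorphM /= evalX.
by apply: linear_kill_pure => q r; rewrite tensM mulr1.
Qed.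

Lemma eval_kernelY p : (forall q r, L (q ⊗ (r * p)) = 0) -> iY p \in eval_kernel.
Proof.
move=> Lp; apply/eval_kernelP => s; rewrite rmorphM /= evalY.
by apply: linear_kill_pure => q r; rewrite tensM mulr1.
Qed.

End Kernel.

(** A column of [D] for each [f j], as in the definition of the global Scheja--Storch
    form; the matrix of the Bezoutian has a row instead. *)
Definition decomposition (f : 'I_n -> A) (D : 'M[R2]_n) :=
  forall j, \sum_i D i j * diffXY k i = iX (f j) - iY (f j).

Hypothesis iX_var : forall i, iX (x i) = bigX k i.
Hypothesis iY_var : forall i, iY (x i) = bigY k i.

Section Decompositions.
Variables (f : 'I_n -> A) (V : lmodType k) (L : {linear T -> V}).
Hypothesis Lfl : forall j q r, L ((q * f j) ⊗ r) = 0.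
Hypothesis Lfr : forall j q r, L (q ⊗ (r * f j)) = 0.

Lemma difference_in_kernel j : iX (f j) - iY (f j) \in eval_kernel L.
Proof.
have idJ := eval_kernel_ideal L.
by apply: idealB => //; [apply: eval_kernelX | apply: eval_kernelY].
Qed.

Lemma decomposition_unique D D' : decomposition f D -> decomposition f D' ->
  L (E (\det D)) = L (E (\det D')).
Proof.
move=> HD HD'; apply/eqP; rewrite -subr_eq0 -linearB -rmorphB; apply/eqP.
apply: eval_kernel0; have idJ := eval_kernel_ideal L.
exact: (det_congruence idJ (@diffXY_regular k n) difference_in_kernel HD HD').
Qed.

Lemma decomposition_map (a : 'M[T]_n) :
    (forall j, f j ⊗ 1 - 1 ⊗ f j = \sum_i a i j * (x i ⊗ 1 - 1 ⊗ x i)) ->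
  decomposition f (map_mx coords a) /\ E (\det (map_mx coords a)) = \det a.
Proof.
move=> Ha; split; last by rewrite det_map_mx eval_coords.
move=> j; have /(congr1 coords) := Ha j; rewrite rmorphB /= coords_tensl coords_tensr => ->.
rewrite rmorph_sum; apply: eq_bigr => i _ /=.
by rewrite mxE rmorphM rmorphB /= coords_tensl coords_tensr iX_var iY_var.
Qed.

Lemma decomposition_eval D : decomposition f D ->
  forall j, f j ⊗ 1 - 1 ⊗ f j = \sum_i map_mx E D i j * (x i ⊗ 1 - 1 ⊗ x i).
Proof.
move=> HD j; have /(congr1 E) := HD j; rewrite rmorphB /= evalX evalY => <-.
rewrite rmorph_sum; apply: eq_bigr => i _ /=.
by rewrite mxE rmorphM rmorphB /= eval_bigX eval_bigY.
Qed.

(** Cramer's rule: [(X_i - Y_i) * \det D] is the entry [i] of [z *m D *m \adj D], and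
    [z *m D] has the entries [f_j(X) - f_j(Y)]. *)
Lemma diff_det_in_kernel D : decomposition f D -> forall i, diffXY k i * \det D \in eval_kernel L.
Proof.
move=> HD i; pose zr : 'rV[R2]_n := \row_i diffXY k i.
have := mulmxA zr D (\adj D); rewrite mul_mx_adj => /matrixP/(_ 0 i).
rewrite mul_mx_scalar mxE mxE mulrC => ->.
have idJ := eval_kernel_ideal L; rewrite mxE; apply: ideal_sum => // j _.
rewrite mulrC; apply: idealM => //; rewrite mxE.
rewrite (eq_bigr (fun i => D i j * diffXY k i)) ?HD ?difference_in_kernel // => l _.
by rewrite mxE mulrC.
Qed.

End Decompositions.
End Doubling.

(** * The dual functional of a grid *)
Section LinearExtension.
Variables (k : fieldType) (n : nat) (w : 'X_{1..n} -> k).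

Definition linear_extension (p : {mpoly k[n]}) : k^o := \sum_(m <- msupp p) p@_m * w m.

Lemma linear_extensionE (p : {mpoly k[n]}) i : (msize p <= i)%N ->
  linear_extension p = \sum_(m : 'X_{1..n < i}) p@_m * w m.
Proof.
move=> le_pi; pose I : subFinType _ := 'X_{1..n < i}.
rewrite /linear_extension (big_mksub I) ?msupp_uniq //=; first last.
  by move=> x /msize_mdeg_lt /leq_trans; apply.
rewrite big_rmcond //= => j /memN_msupp_eq0 ->.
by rewrite mul0r.
Qed.

Lemma linear_extension_linear : linear linear_extension.
Proof.
move=> c p q; pose i := maxn (msize (c *: p + q)) (maxn (msize p) (msize q)).
rewrite !(@linear_extensionE _ i) ?leq_max ?leqnn ?orbT //.
rewrite scaler_sumr -big_split; apply: eq_bigr => m _.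
by rewrite mcoeffD mcoeffZ mulrDl -mulrA.
Qed.
HB.instance Definition _ :=
  GRing.isLinear.Build k {mpoly k[n]} k^o _ linear_extension linear_extension_linear.

Lemma linear_extensionX m : linear_extension 'X_[m] = w m.
Proof. by rewrite /linear_extension msuppX big_seq1 mcoeffX eqxx mul1r. Qed.

End LinearExtension.

Section OneVariable.

(** The quotients [drop_poly a.+1 G] of [G] by ['X^a.+1] are the coefficients of the
    difference quotient of [G] as a polynomial in [x]: Horner's scheme makes the
    product telescope. *)
Lemma horner_diff (R : comNzRingType) (G : {poly R}) (x y : R) N : (size G <= N)%N ->
  (x - y) * (\sum_(a < N) x ^+ a * (drop_poly a.+1 G).[y]) = G.[x] - G.[y].
Proof.
move=> le_N.
have dropS a : (drop_poly a G).[y] = G`_a + y * (drop_poly a.+1 G).[y].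
  have -> : drop_poly a G = (G`_a)%:P + 'X * drop_poly a.+1 G.
    apply/polyP => b; rewrite coefD coefC coefXM !coef_drop_poly.
    by case: b => [|b] /=; rewrite ?addr0 // add0r addSnnS.
  by rewrite hornerD hornerC hornerM hornerX.
pose u a := x ^+ a * (drop_poly a G).[y].
rewrite mulr_sumr (eq_bigr (fun a : 'I_N => (u a.+1 - u a) + G`_a * x ^+ a)); last first.
  move=> a _; rewrite /u [(drop_poly a G).[y]]dropS exprS mulrDr [x ^+ a * G`_a]mulrC.
  by rewrite opprD addrA addrAC subrK [x ^+ a * (y * _)]mulrCA mulrBl !mulrA.
rewrite big_split /= -(horner_coef_wide x le_N).
rewrite -(big_mkord predT (fun a => u a.+1 - u a)) telescope_sumr // /u.
rewrite drop_poly_eq0 // horner0 mulr0 drop_poly0l expr0 mul1r addrC.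
by rewrite sub0r.
Qed.

End OneVariable.

Section TopCoefficient.
Variables (k : fieldType) (G : {poly k}).
Hypotheses (monG : G \is monic) (szG : (1 < size G)%N).

(** With a one-variable [G] of degree [d], the coefficient of ['X^(d - 1)] in the
    remainder modulo [G], which is the dual functional of [k[X] / (G)]. *)
Definition top_coef (q : {poly k}) : k^o := (q %% G)`_(size G).-2.

Lemma top_coef_linear : linear top_coef.
Proof. by move=> c p q; rewrite /top_coef modpD modpZl coefD coefZ. Qed.
HB.instance Definition _ := GRing.isLinear.Build k {poly k} k^o _ top_coef top_coef_linear.

Lemma top_coef_mul q : top_coef (q * G) = 0.
Proof. by rewrite /top_coef modp_mull coef0. Qed.

(** Contracting the difference quotient of [G]: for [a] below the degree of [G] the
    power ['X^a] is its own remainder, so only [a = deg G - 1] counts, where the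
    coefficient is the leading one; beyond the degree the coefficients vanish. *)
Lemma top_coef_drop N : (size G <= N)%N ->
  \sum_(a < N) (top_coef 'X^a : k) *: drop_poly a.+1 G = 1.
Proof.
move=> le_N; have lt_N : ((size G).-2 < N)%N.
  by rewrite (leq_trans _ le_N) //; case: (size G) szG => [|[|m]].
rewrite (bigD1 (Ordinal lt_N)) //= big1 ?addr0; last first.
  move=> a; rewrite -val_eqE /= => ne_a.
  have [lt_a|le_a] := ltnP a (size G).-1.
    rewrite /top_coef modp_small ?size_polyXn; last first.
      by case: (size G) lt_a => //.
    by rewrite coefXn eq_sym (negPf ne_a) scale0r.
  rewrite drop_poly_eq0 ?scaler0 //.
  by case: (size G) le_a.
have lt_d : ((size G).-2.+1 < size G)%N by case: (size G) szG => [|[|m]].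
have Ed : (size G).-2.+1 = (size G).-1 by case: (size G) szG => [|[|m]].
rewrite /top_coef modp_small ?size_polyXn // coefXn eqxx scale1r Ed.
apply/polyP => b; rewrite coef_drop_poly coef1; case: b => [|b].
  by rewrite add0n -lead_coefE (monicP monG).
by rewrite nth_default // addSn; case: (size G) szG => // m _; rewrite ltnS leq_addl.
Qed.

End TopCoefficient.

Section ResidueFunctional.
Variables (k : fieldType) (n : nat) (G : 'I_n -> {poly k}).
Local Notation P := {mpoly k[n]}.

Definition grid_weight (m : 'X_{1..n}) : k := \prod_i top_coef (G i) 'X^(m i).

Definition grid_functional : P -> k^o := linear_extension grid_weight.
HB.instance Definition _ := GRing.Linear.copy grid_functional (linear_extension grid_weight).

Lemma grid_functionalX (e : 'I_n -> nat) :
  grid_functional (\prod_i 'X_i ^+ e i) = \prod_i top_coef (G i) 'X^(e i).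
Proof.
rewrite (_ : \prod_i _ = 'X_[[multinom e i | i < n]]).
  by rewrite /grid_functional linear_extensionX; apply: eq_bigr => i _; rewrite mnmE.
by rewrite mpolyXE_id; apply: eq_bigr => i _; rewrite mnmE.
Qed.

(** On a monomial the functional is a product over the variables, hence multiplication
    by a polynomial in [x_i] acts on the factor [i] alone, where multiples of [G i]
    give zero. *)
Lemma grid_functional_kill i p : grid_functional (univariate i (G i) * p) = 0.
Proof.
suff kill m : grid_functional (univariate i (G i) * 'X_[m]) = 0.
  elim/mpolyind: p => [|c m p _ _ IH]; first by rewrite mulr0 linear0.
  by rewrite mulrDr linearD /= IH addr0 -scalerAr linearZ /= kill scaler0.
have shift e : grid_functional ('X_i ^+ e * 'X_[m]) =
    top_coef (G i) ('X^e * 'X^(m i)) * \prod_(j | j != i) top_coef (G j) 'X^(m j).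
  pose d j := if j == i then (e + m j)%N else m j.
  have -> : 'X_i ^+ e * 'X_[m] = \prod_j 'X_j ^+ d j :> P.
    rewrite ['X_[m]]mpolyXE_id [X in _ * X](bigD1 i) //= [RHS](bigD1 i) //= /d eqxx exprD mulrA.
    by congr (_ * _); apply: eq_bigr => j /negPf->.
  rewrite grid_functionalX (bigD1 i) //= /d eqxx exprD; congr (_ * _).
  by apply: eq_bigr => j /negPf->.
rewrite univariateE mulr_suml linear_sum /=.
rewrite (eq_bigr (fun e : 'I_(size (G i)) => top_coef (G i) ((G i)`_e *: 'X^e * 'X^(m i)) *
   \prod_(j | j != i) top_coef (G j) 'X^(m j))); last first.
  by move=> e _; rewrite -!scalerAl !linearZ /= shift /GRing.scale /= mulrA.
rewrite -mulr_suml -linear_sum -mulr_suml.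
by rewrite -poly_def coefK /= [G i * _]mulrC top_coef_mul mul0r.
Qed.

End ResidueFunctional.

(** * Contraction and the transformation law *)
Section Slice.
Variables (k : fieldType) (V W : lmodType k) (l : {linear V -> k^o}).

Definition slice (t : tensor V W) : W := tensor_lift (fun v w => (l v : k) *: w) t.

Let slice_l (w : W) : linear (fun v : V => (l v : k) *: w).
Proof. by move=> c u v; rewrite linearP scalerDl scalerA. Qed.
Let slice_r v : linear (fun w : W => (l v : k) *: w).
Proof. by move=> c u w; rewrite scalerDr !scalerA mulrC. Qed.

Lemma slice_linear : linear slice.
Proof.
exact: (tensor_lift_linear (beta := fun (v : V) (w : W) => (l v : k) *: w) slice_l slice_r).
Qed.
HB.instance Definition _ := GRing.isLinear.Build k (tensor V W) W _ slice slice_linear.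

Lemma slice_tens v w : slice (v ⊗ w) = (l v : k) *: w.
Proof.
exact: (tensor_lift_tens (beta := fun (v : V) (w : W) => (l v : k) *: w) slice_l slice_r).
Qed.

End Slice.

Section TensorMap.
Variables (k : fieldType) (V W V' W' : lmodType k).
Variables (r : {linear V -> V'}) (s : {linear W -> W'}).

Definition tensor_map (t : tensor V W) : tensor V' W' :=
  tensor_lift (fun v w => r v ⊗ s w) t.

Let tmap_l w : linear (fun v => r v ⊗ s w).
Proof. by move=> c u v; rewrite linearP tensDl tensZl. Qed.
Let tmap_r v : linear (fun w => r v ⊗ s w).
Proof. by move=> c u w; rewrite linearP tensDr tensZr. Qed.

Lemma tensor_map_linear : linear tensor_map.
Proof. exact: (tensor_lift_linear (beta := fun v w => r v ⊗ s w) tmap_l tmap_r). Qed.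
HB.instance Definition _ :=
  GRing.isLinear.Build k (tensor V W) (tensor V' W') _ tensor_map tensor_map_linear.

Lemma tensor_map_tens v w : tensor_map (v ⊗ w) = r v ⊗ s w.
Proof. exact: (tensor_lift_tens (beta := fun v w => r v ⊗ s w) tmap_l tmap_r). Qed.

Lemma slice_tensor_map (l : {linear V' -> k^o}) (l' : {linear V -> k^o}) t :
  (forall v, l' v = l (r v)) -> slice l (tensor_map t) = s (slice l' t).
Proof.
move=> El; elim/tensor_ind: t => [|c v w t IH]; first by rewrite !linear0.
rewrite -tensZl !linearD /= IH tensor_map_tens !slice_tens -El; congr (_ + _).
by rewrite [RHS]linearZ.
Qed.

End TensorMap.

Section SliceAlgebra.
Variables (k : fieldType) (A B : comAlgType k).
Local Notation T := (tensor A B).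

Lemma slice_tensl (l l' : {linear A -> k^o}) p (t : T) :
  (forall q, l' q = l (p * q)) -> slice l (tensl p * t) = slice l' t.
Proof.
move=> El; elim/tensor_ind: t => [|c v w t IH]; first by rewrite mulr0 !linear0.
by rewrite -tensZl mulrDr !linearD /= IH tensM mul1r !slice_tens El.
Qed.

Lemma slice_tensr (l : {linear A -> k^o}) q (t : T) : slice l (tensr q * t) = q * slice l t.
Proof.
elim/tensor_ind: t => [|c v w t IH]; first by rewrite mulr0 !linear0 mulr0.
rewrite -tensZl mulrDr !linearD /= mulrDr IH tensM mul1r !slice_tens.
by rewrite scalerAr.
Qed.

End SliceAlgebra.

Lemma det_entrywise (R : comNzRingType) (I : {pred R}) n (M M' : 'M[R]_n) : ideal I ->
  (forall i j, M i j - M' i j \in I) -> \det M - \det M' \in I.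
Proof.
move=> idI IM; have I0 : 0 \in I by case: idI.
apply: (big_ind2 (fun x y => x - y \in I)); first by rewrite subrr.
  by move=> x x' y y' Ix Iy; rewrite opprD addrACA idealD.
move=> s _; rewrite -mulrBr; apply: idealM => //.
apply: (big_ind2 (fun x y => x - y \in I)) => //; first by rewrite subrr.
move=> x x' y y' Ix Iy.
have -> : x * y - x' * y' = x * (y - y') + y' * (x - x').
  by rewrite !mulrBr [y' * x]mulrC [y' * x']mulrC addrA subrK.
by apply: idealD => //; apply: idealM.
Qed.

Section DualFunctional.
Variables (k : fieldType) (n : nat) (A : comAlgType k) (x : 'I_n -> A).
Local Notation T := (tensor A A).
Local Notation R2 := {mpoly k[n + n]}.
Local Notation E := (tensor_eval (double_var x)).
Variables (iX iY : {lrmorphism A -> R2}).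
Hypothesis evalX : forall p, E (iX p) = tensl p.
Hypothesis evalY : forall p, E (iY p) = tensr p.
Hypothesis iX_var : forall i, iX (x i) = bigX k i.
Hypothesis diff_span : forall p, exists h : 'I_n -> R2, iX p - iY p = \sum_i h i * diffXY k i.

(** The determinant is killed by all [p ⊗ 1 - 1 ⊗ p], since [p(X) - p(Y)] is a combination
    of the [X_i - Y_i]. *)
Lemma eval_det_diagonal (V : lmodType k) (L : {linear T -> V}) (f : 'I_n -> A) D p :
    (forall j q r, L ((q * f j) ⊗ r) = 0) -> (forall j q r, L (q ⊗ (r * f j)) = 0) ->
    decomposition iX iY f D ->
  L (tensl p * E (\det D)) = L (tensr p * E (\det D)).
Proof.
move=> Lfl Lfr HD; apply/eqP; rewrite -subr_eq0 -linearB -mulrBl; apply/eqP.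
rewrite -evalX -evalY -rmorphB -rmorphM; apply: eval_kernel0.
have [h ->] := diff_span p; have idJ := eval_kernel_ideal x L.
rewrite mulr_suml; apply: ideal_sum => // i _; rewrite -mulrA; apply: idealM => //.
exact: (diff_det_in_kernel evalX evalY Lfl Lfr HD).
Qed.

(** Each term of the expanded product is a pure tensor, on which [l] is multiplicative
    across the variables. *)
Lemma slice_grid (l : {linear A -> k^o}) N (w : 'I_n -> nat -> k) (c : 'I_n -> 'I_N -> A) :
    (forall e : 'I_n -> nat, l (\prod_i x i ^+ e i) = \prod_i w i (e i)) ->
  slice l (E (\prod_i \sum_(a < N) bigX k i ^+ a * iY (c i a))) =
    \prod_i \sum_(a < N) w i a *: c i a.
Proof.
move=> lw; rewrite !bigA_distr_bigA /= rmorph_sum linear_sum /=.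
apply: eq_bigr => e _.
have -> : \prod_i (bigX k i ^+ e i * iY (c i (e i))) =
          iX (\prod_i x i ^+ e i) * iY (\prod_i c i (e i)).
  rewrite big_split /= !rmorph_prod; congr (_ * _).
  by apply: eq_bigr => i _; rewrite rmorphXn /= iX_var.
rewrite rmorphM /= evalX evalY -tens_lr slice_tens (lw (fun i => e i)).
by rewrite scaler_prod.
Qed.

Section Transformation.
Variables (f g : 'I_n -> A) (b : 'M[A]_n) (D : 'M[R2]_n).
Hypothesis gE : forall i, g i = \sum_j b i j * f j.
Hypothesis HD : decomposition iX iY f D.
Variables (N : nat) (w : 'I_n -> nat -> k) (c : 'I_n -> 'I_N -> A).
Let beta i := \sum_(a < N) bigX k i ^+ a * iY (c i a).
Hypothesis betaE : forall i, beta i * diffXY k i = iX (g i) - iY (g i).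
Hypothesis wc : forall i, \sum_(a < N) w i a *: c i a = 1.
Variables (l : {linear A -> k^o}) (V : lmodType k) (r : {linear A -> V}).
Hypothesis lw : forall e : 'I_n -> nat, l (\prod_i x i ^+ e i) = \prod_i w i (e i).
Hypothesis lg : forall i p, l (g i * p) = 0.
Hypothesis rf : forall j p, r (p * f j) = 0.

(** If [l] contracts the Bezoutian of [g] to [1], then [l (\det b * _)] contracts that of
    [f] to the class of [1].  Modulo the [f_j(Y)] the matrix [M] is the same as
    [M'], which decomposes [g] exactly; so does the diagonal matrix [Beta], and the
    decomposition of [g] is unique up to the kernel of [r \o slice l]. *)
Lemma slice_transformation : r (slice l (tensl (\det b) * E (\det D))) = r 1.
Proof.
pose L : {linear T -> V} := r \o slice l.
have idJ := eval_kernel_ideal x L; set J := eval_kernel x L in idJ.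
have Jf j : iY (f j) \in J.
  by apply: eval_kernelY => // q s; rewrite /= slice_tens linearZ /= rf scaler0.
have JgX i : iX (g i) \in J.
  by apply: eval_kernelX => // q s; rewrite /= slice_tens mulrC lg scale0r linear0.
have JgY i : iY (g i) \in J.
  rewrite gE rmorph_sum; apply: ideal_sum => // j _ /=.
  by rewrite rmorphM /=; apply: (idealM idJ); apply: Jf.
pose h i j := sval (cid (diff_span (b i j))).
have hE i j : iX (b i j) - iY (b i j) = \sum_l h i j l * diffXY k l.
  exact: svalP (cid (diff_span (b i j))).
pose M := D *m (map_mx iX b)^T.
(* Writing b(X) (f(X) - f(Y)) = g(X) - g(Y) - (b(X) - b(Y)) f(Y) shows which
   correction makes [M] a decomposition of [g]. *)
pose M' : 'M[R2]_n := \matrix_(i, l) (M i l + \sum_j h l j i * iY (f j)).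
pose Beta : 'M[R2]_n := diag_mx (\row_i beta i).
have M'g i : \sum_l M' l i * diffXY k l = iX (g i) - iY (g i).
  under eq_bigr do rewrite mxE mulrDl.
  rewrite big_split /= gE !rmorph_sum /= -sumrB.
  have -> : \sum_l M l i * diffXY k l = \sum_j iX (b i j) * (iX (f j) - iY (f j)).
    under eq_bigr do rewrite mxE mulr_suml.
    rewrite exchange_big; apply: eq_bigr => j _; rewrite -HD mulr_sumr.
    by apply: eq_bigr => l' _; rewrite !mxE mulrAC mulrC.
  have -> : \sum_l (\sum_j h i j l * iY (f j)) * diffXY k l =
            \sum_j (iX (b i j) - iY (b i j)) * iY (f j).
    under eq_bigr do rewrite mulr_suml.
    rewrite exchange_big; apply: eq_bigr => j _; rewrite hE mulr_suml.
    by apply: eq_bigr => l' _; rewrite mulrAC.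
  rewrite -big_split; apply: eq_bigr => j _ /=.
  by rewrite !rmorphM mulrBl mulrBr addrA subrK.
have Betag i : \sum_l Beta l i * diffXY k l = iX (g i) - iY (g i).
  rewrite (bigD1 i) //= !mxE eqxx mulr1n betaE big1 ?addr0 // => j nj.
  by rewrite !mxE (negPf nj) mulr0n mul0r.
have JM' : \det M' - \det Beta \in J.
  apply: (det_congruence idJ (@diffXY_regular k n) _ M'g Betag) => i.
  exact: idealB.
have JM : \det M' - \det M \in J.
  apply: det_entrywise => // i j; rewrite mxE addrAC subrr add0r.
  by apply: ideal_sum => // j' _; apply: (idealM idJ); apply: Jf.
have detM : tensl (\det b) * E (\det D) = E (\det M).
  by rewrite det_mulmx det_tr det_map_mx rmorphM /= evalX mulrC.
have EM : L (E (\det M)) = L (E (\det Beta)).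
  apply/eqP; rewrite -subr_eq0 -linearB -rmorphB; apply/eqP/eval_kernel0.
  have -> : \det M - \det Beta = (\det M' - \det Beta) - (\det M' - \det M).
    by rewrite opprB [RHS]addrC addrA subrK.
  exact: (idealB idJ JM' JM).
rewrite detM -[LHS]/(L _) EM /= det_diag; congr (r _).
rewrite (eq_bigr beta); last by move=> i _; rewrite mxE.
by rewrite (slice_grid c lw) big1.
Qed.

End Transformation.
End DualFunctional.

(** * The quotient algebra *)
Section Specialization.
Variables (k : fieldType) (n : nat).
Local Notation P := {mpoly k[n]}.
Local Notation R2 := {mpoly k[n + n]}.
Local Notation T := (tensor P P).
Local Notation coord := (fun i : 'I_n => 'X_i : P).
Local Notation EP := (tensor_eval (double_var coord)).

HB.instance Definition _ :=
  GRing.isScalable.Build k P R2 _ (@inX k n) (fun c p => comp_mpolyZ c p _).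
HB.instance Definition _ :=
  GRing.isScalable.Build k P R2 _ (@inY k n) (fun c p => comp_mpolyZ c p _).

Lemma eval_inX (p : P) : EP (inX p) = tensl p.
Proof.
apply: (morphism_eq (phi := EP \o @inX k n) (psi := @tensl k P P)) => [c|i] /=.
  by rewrite inXC tensor_evalC alg_mpolyC.
by rewrite inX_var eval_bigX.
Qed.

Lemma eval_inY (p : P) : EP (inY p) = tensr p.
Proof.
apply: (morphism_eq (phi := EP \o @inY k n) (psi := @tensr k P P)) => [c|i] /=.
  by rewrite inYC tensor_evalC -tensr_scale alg_mpolyC.
by rewrite inY_var eval_bigY.
Qed.

Lemma in_diff_span (p : P) : exists h : 'I_n -> R2, inX p - inY p = \sum_i h i * diffXY k i.
Proof.
have [h Eh] := comp_mpoly_diff p [tuple bigX k i | i < n] [tuple bigY k i | i < n].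
by exists h; rewrite [LHS]Eh; apply: eq_bigr => i _; rewrite !tnth_mktuple.
Qed.

Lemma bezout_evalE (h : R2) : bezout_eval h = EP h.
Proof. by []. Qed.

(** The two substitutions agree except at [Y_j] and [X_j], so their difference is a
    multiple of [X_j - Y_j]. *)
Lemma bezout_matrix_exists (f : 'I_n -> P) : exists D, bezout_matrix f D.
Proof.
have ex (i j : 'I_n) : exists d, d * (bigX k j - bigY k j) = subst_YX j (f i) - subst_YX j.+1 (f i).
  have [h Eh] := comp_mpoly_diff (f i)
    [tuple if (l < j)%N then bigY k l else bigX k l | l < n]
    [tuple if (l < j.+1)%N then bigY k l else bigX k l | l < n].
  exists (h j); rewrite [RHS]Eh (bigD1 j) //= big1 ?addr0; last first.
    move=> l /negPf nl; rewrite !tnth_mktuple ltnS [(l <= j)%N]leq_eqVlt.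
    by rewrite -[l == j :> nat]/(l == j) nl subrr mulr0.
  by rewrite !tnth_mktuple ltnn leqnn.
exists (\matrix_(i, j) sval (cid (ex i j))) => i j; rewrite mxE.
exact: (svalP (cid (ex i j))).
Qed.

Lemma bezout_decomposition (f : 'I_n -> P) D : bezout_matrix f D ->
  decomposition (@inX k n) (@inY k n) f D^T.
Proof.
move=> HD i /=; rewrite -inX_subst -inY_subst -opprB.
rewrite -(telescope_sumr (fun j => subst_YX j (f i)) (leq0n n)) big_mkord -sumrN.
by apply: eq_bigr => j _; rewrite mxE HD opprB.
Qed.

Variable f : 'I_n -> P.
Local Notation Q := (quotient_algebra f).

Lemma residue2E t : residue2 f t = tensor_map (residue f) (residue f) t.
Proof. by []. Qed.

Lemma contractE (t : tensor Q Q) phi : contract t phi = slice phi t.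
Proof. by []. Qed.

Lemma residue_gen p j : residue f (p * f j) = 0.
Proof. by apply/eqP; rewrite residue_eq0 generated_idealM ?mem_generated_ideal. Qed.
End Specialization.

Section Univariate.
Variables (k : fieldType) (n : nat) (i : 'I_n).
Local Notation P := {mpoly k[n]}.
Local Notation lift h := (map_poly (@mpolyC (n + n) k) h).

Lemma univariate_lincomb (I : finType) (c : I -> k) (h : I -> {poly k}) :
  univariate i (\sum_j c j *: h j) = \sum_j c j *: univariate i (h j).
Proof.
rewrite /univariate rmorph_sum horner_sum; apply: eq_bigr => j _ /=.
by rewrite map_polyZ hornerZ mul_mpolyC.
Qed.

Lemma inX_univariate h : inX (univariate i h) = (lift h).[bigX k i].
Proof.
rewrite univariateE linear_sum horner_coef size_map_poly; apply: eq_bigr => e _.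
by rewrite linearZ rmorphXn /= inX_var coef_map mul_mpolyC.
Qed.

Lemma inY_univariate h : inY (univariate i h) = (lift h).[bigY k i].
Proof.
rewrite univariateE linear_sum horner_coef size_map_poly; apply: eq_bigr => e _.
by rewrite linearZ rmorphXn /= inY_var coef_map mul_mpolyC.
Qed.

Lemma drop_poly_map h a : lift (drop_poly a h) = drop_poly a (lift h).
Proof. by apply/polyP => b; rewrite coef_map !coef_drop_poly coef_map. Qed.

End Univariate.

Section Nondegeneracy.
Variables (k : fieldType) (n : nat) (f : 'I_n -> {mpoly k[n]}).
Local Notation P := {mpoly k[n]}.
Local Notation R2 := {mpoly k[n + n]}.
Local Notation Q := (quotient_algebra f).
Local Notation coord := (fun i : 'I_n => 'X_i : P).
Local Notation EP := (tensor_eval (double_var coord)).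

Section Grid.
Variables (G : 'I_n -> {poly k}) (b : 'M[P]_n).
Hypothesis monG : forall i, G i \is monic.
Hypothesis szG : forall i, (1 < size (G i))%N.
Hypothesis gE : forall i, univariate i (G i) = \sum_j b i j * f j.

(** Cramer's rule: [\det b * f_j] is the combination of the [G_i(x_i)] with coefficients
    from the adjugate of [b]. *)
Lemma grid_det_kill u : u \in generated_ideal f -> grid_functional G (\det b * u) = 0.
Proof.
case/generated_idealP => p ->; rewrite mulr_sumr linear_sum big1 //= => j _.
have -> : \det b * (p j * f j) = \sum_i univariate i (G i) * (\adj b j i * p j).
  have detf : \det b * f j = \sum_i \adj b j i * univariate i (G i).
    have := mulmxA (\adj b) b (\col_i f i); rewrite mul_adj_mx => /matrixP/(_ j 0).
    rewrite mul_scalar_mx mxE [RHS]mxE [X in _ * X]mxE => <-.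
    apply: eq_bigr => i _; congr (_ * _); rewrite gE mxE.
    by apply: eq_bigr => l _; rewrite mxE.
  rewrite mulrCA detf mulr_sumr; apply: eq_bigr => i _.
  by rewrite mulrA mulrC [p j * _]mulrC.
by rewrite linear_sum big1 //= => i _; rewrite grid_functional_kill.
Qed.

Definition quotient_functional (q : Q) : k^o := grid_functional G (\det b * repr q).

Lemma quotient_functional_residue p :
  quotient_functional (residue f p) = grid_functional G (\det b * p).
Proof.
apply/eqP; rewrite -subr_eq0 -linearB -mulrBr; apply/eqP/grid_det_kill.
by apply/residue_eq; rewrite residue_reprK.
Qed.

Lemma quotient_functional_linear : linear quotient_functional.
Proof.
move=> c q q'; rewrite -[q]residue_reprK -[q']residue_reprK -linearP /=.
by rewrite !quotient_functional_residue mulrDr linearD -scalerAr linearZ.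
Qed.

Definition quotient_form : {linear Q -> k^o} :=
  HB.pack quotient_functional (GRing.isLinear.Build k Q k^o _ _ quotient_functional_linear).

Lemma contract_quotient_functional D : decomposition (@inX k n) (@inY k n) f D ->
  contract (residue2 f (EP (\det D))) quotient_form = 1.
Proof.
move=> HD; rewrite contractE residue2E.
pose l' : {linear P -> k^o} := quotient_form \o residue f.
rewrite (@slice_tensor_map _ _ _ _ _ _ _ _ l') //.
rewrite -(@slice_tensl _ _ _ (grid_functional G) _ (\det b)); last first.
  by move=> q; rewrite /l' /= quotient_functional_residue.
pose N := \max_i size (G i).
have le_N i : (size (G i) <= N)%N by apply: (leq_bigmax i).
rewrite (slice_transformation (@eval_inX k n) (@eval_inY k n) (@inX_var k n)
  (@in_diff_span k n) gE HD (N := N) (w := fun i e => top_coef (G i) 'X^e)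
  (c := fun i (a : 'I_N) => univariate i (drop_poly a.+1 (G i)))) ?rmorph1 //.
- move=> i /=; rewrite inX_univariate inY_univariate -(@horner_diff _ _ _ _ N); last first.
    by rewrite size_map_poly.
  by rewrite mulrC; congr (_ * _); apply: eq_bigr => a _; rewrite inY_univariate drop_poly_map.
- by move=> i; rewrite -univariate_lincomb top_coef_drop // univariate1.
- exact: grid_functionalX.
- exact: grid_functional_kill.
- by move=> j p; apply: residue_gen.
Qed.

End Grid.

(** The factor ['X] ensures positive degree even when [f] generates the unit ideal, where
    the polynomial obtained could be constant. *)
Lemma exists_grid : only_isolated_zeros f ->
  exists (G : 'I_n -> {poly k}) (b : 'M[P]_n), 
    [/\ forall i, G i \is monic, forall i, (1 < size (G i))%N &
        forall i, univariate i (G i) = \sum_j b i j * f j].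
Proof.
move=> hf.
have ex i : exists G : {poly k},
    [/\ G \is monic, (1 < size G)%N & univariate i G \in generated_ideal f].
  have [h h0 fh] := isolated_zeros_univariate hf i.
  exists ('X * ((lead_coef h)^-1 *: h)).
  have lh0 : lead_coef h != 0 by rewrite lead_coef_eq0.
  split.
  - by rewrite monicE lead_coefM lead_coefX mul1r lead_coefZ mulVf.
  - rewrite mulrC size_mulX ?scaler_eq0 ?invr_eq0 ?negb_or ?lh0 //.
    by rewrite size_scale ?invr_eq0 // ltnS size_poly_gt0.
  rewrite -mul_polyC mulrA univariateM; exact: generated_idealM.
pose G i := sval (cid (ex i)).
have GP i : [/\ G i \is monic, (1 < size (G i))%N & univariate i (G i) \in generated_ideal f].
  exact: svalP (cid (ex i)).
have exb i : exists bi : 'I_n -> P, univariate i (G i) = \sum_j bi j * f j.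
  by apply/generated_idealP; case: (GP i).
exists G, (\matrix_(i, j) sval (cid (exb i)) j); split=> i; try by case: (GP i).
rewrite (svalP (cid (exb i))); apply: eq_bigr => j _; by rewrite mxE.
Qed.

Lemma exists_contract1 : only_isolated_zeros f ->
  forall D, decomposition (@inX k n) (@inY k n) f D ->
  exists phi : {linear Q -> k^o}, contract (residue2 f (EP (\det D))) phi = 1.
Proof.
move=> /exists_grid[G [b [monG szG gE]]] D HD.
by exists (quotient_form gE); apply: contract_quotient_functional.
Qed.

End Nondegeneracy.

(** * Bases and duality *)
Section Bases.
Variables (k : fieldType) (V : lmodType k).

Definition spans (I : finType) (v : I -> V) := forall x, exists c : I -> k, x = \sum_i c i *: v i.

Lemma spans_minimal (I : finType) (v : I -> V) : spans v ->
  exists d (a : 'I_d -> V), spans a /\ forall d' (a' : 'I_d' -> V), spans a' -> (d <= d')%N.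
Proof.
move=> spv; have ex : exists d, `[< exists a : 'I_d -> V, spans a >].
  exists #|I|; apply/asboolP; exists (v \o enum_val) => x; have [c ->] := spv x.
  by exists (c \o enum_val); rewrite (reindex _ (onW_bij _ (enum_val_bij I))).
case: (ex_minnP ex) => d /asboolP[a spa] min_d.
exists d, a; split=> // d' a' spa'; apply/min_d/asboolP; by exists a'.
Qed.

Lemma minimal_spanning_free d (a : 'I_d -> V) :
    spans a -> (forall d' (a' : 'I_d' -> V), spans a' -> (d <= d')%N) ->
  forall e : 'I_d -> k, \sum_i e i *: a i = 0 -> forall i, e i = 0.
Proof.
case: d a => [|d] a spa min_d e e0 j; first by case: j.
apply/eqP/negP => /negP ej.
have aj : a j = \sum_i (- (e j)^-1 * e (lift j i)) *: a (lift j i).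
  move/eqP: e0; rewrite (bigD1_ord j) //= addr_eq0 => /eqP/(congr1 ( *:%R (e j)^-1)).
  rewrite scalerA mulVf // scale1r => ->.
  rewrite scalerN scaler_sumr -sumrN; apply: eq_bigr => i _.
  by rewrite scalerA mulNr scaleNr.
suff /min_d : spans (a \o lift j) by rewrite ltnn.
move=> x; have [c ->] := spa x.
exists (fun i => c (lift j i) + c j * (- (e j)^-1 * e (lift j i))).
rewrite (bigD1_ord j) //= aj scaler_sumr addrC -big_split.
by apply: eq_bigr => i _; rewrite /= scalerA -scalerDl.
Qed.

Lemma spans_linear_basis (I : finType) (v : I -> V) : spans v ->
  exists d (a : 'I_d -> V), linear_basis a.
Proof.
move=> /spans_minimal[d [a [spa min_d]]]; exists d, a => x.
have [c ->] := spa x; exists [ffun i => c i]; split.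
  by apply: eq_bigr => i _; rewrite ffunE.
move=> c' Ec; apply/ffunP => i; rewrite ffunE; apply/eqP; rewrite -subr_eq0; apply/eqP.
apply: (minimal_spanning_free spa min_d (e := fun i => c i - c' i)).
by under eq_bigr do rewrite scalerBl; rewrite sumrB Ec subrr.
Qed.

Lemma basis_tensor (W : lmodType k) d (a : 'I_d -> V) (t : tensor V W) : linear_basis a ->
  exists b : 'I_d -> W, t = \sum_i a i ⊗ b i.
Proof.
move=> basa; elim/tensor_ind: t => [|c v w t [b Et]].
  by exists (fun=> 0); rewrite big1 // => i _; rewrite -(scale0r (0 : W)) tensZr scale0r.
have [e [-> _]] := basa v; exists (fun i => c *: (e i *: w) + b i).
rewrite Et -tensZl scaler_sumr.
have -> : (\sum_i c *: (e i *: a i)) ⊗ w = \sum_i a i ⊗ (c *: (e i *: w)).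
  elim/big_rec2: _ => [|i y1 y2 _ IH]; first by rewrite -(scale0r (0 : V)) tensZl scale0r.
  by rewrite tensDl IH !tensZl !tensZr.
by rewrite -big_split; apply: eq_bigr => i _; rewrite /= tensDr.
Qed.

End Bases.

Section QuotientBasis.
Variables (k : fieldType) (n : nat) (f : 'I_n -> {mpoly k[n]}).
Local Notation P := {mpoly k[n]}.
Local Notation Q := (quotient_algebra f).

(** Reducing each power of [x_i] modulo [G i] shows that finitely many monomials span. *)
Lemma quotient_basis : only_isolated_zeros f ->
  exists d (a : 'I_d -> Q), linear_basis a.
Proof.
move=> /exists_grid[G [b [monG szG gE]]].
have Gf i : univariate i (G i) \in generated_ideal f.
  by apply/generated_idealP; exists (b i).
pose N := \max_i size (G i).
have le_N i : (size (G i) <= N)%N by apply: (leq_bigmax i).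
pose mono (e : {ffun 'I_n -> 'I_N}) : P := \prod_i 'X_i ^+ e i.
apply: (@spans_linear_basis _ _ _ (residue f \o mono)) => x.
have power i m : residue f ('X_i ^+ m) =
    residue f (\sum_(a < N) ('X^m %% G i)`_a *: 'X_i ^+ a).
  have uX : univariate i ('X^m : {poly k}) = 'X_i ^+ m.
    by rewrite /univariate map_polyXn hornerXn.
  have le_r : (size ('X^m %% G i)%R <= N)%N.
    by rewrite (leq_trans _ (le_N i)) // ltnW // ltn_modp monic_neq0.
  rewrite -uX {1}(divp_eq 'X^m (G i)); apply/residue_eq.
  have -> : univariate i ('X^m %/ G i * G i + 'X^m %% G i) =
            univariate i ('X^m %/ G i) * univariate i (G i) + univariate i ('X^m %% G i).
    by rewrite -univariateM /univariate rmorphD hornerD.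
  have -> : univariate i ('X^m %% G i) = \sum_(a < N) ('X^m %% G i)`_a *: 'X_i ^+ a.
    rewrite univariateE (big_ord_widen _ (fun a => ('X^m %% G i)`_a *: 'X_i ^+ a) le_r).
    rewrite big_mkcond; apply: eq_bigr => a _ /=; case: ltnP => // le_a.
    by rewrite nth_default // scale0r.
  by rewrite addrK generated_idealM.
have monomial m : exists c : {ffun 'I_n -> 'I_N} -> k,
    residue f 'X_[m] = \sum_e c e *: residue f (mono e).
  exists (fun e : {ffun 'I_n -> 'I_N} => \prod_i ('X^(m i) %% G i)`_(e i)).
  rewrite mpolyXE_id rmorph_prod (eq_bigr _ (fun i _ => power i (m i))).
  rewrite -rmorph_prod bigA_distr_bigA /= linear_sum; apply: eq_bigr => e _ /=.
  by rewrite scaler_prod linearZ.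
pose c m := sval (cid (monomial m)).
have cE m : residue f 'X_[m] = \sum_e c m e *: residue f (mono e).
  exact: svalP (cid (monomial m)).
exists (fun e => \sum_(m <- msupp (repr x)) (repr x)@_m * c m e).
rewrite -{1}[x]residue_reprK {1}[repr x]mpolyE linear_sum.
under [RHS]eq_bigr do rewrite scaler_suml.
rewrite exchange_big; apply: eq_bigr => m _ /=.
rewrite linearZ /= cE scaler_sumr; apply: eq_bigr => e _.
by rewrite scalerA.
Qed.

Lemma quotient_scaleAr c (x y : Q) : c *: (x * y) = x * (c *: y).
Proof. by rewrite -![c *: _]/(residue f c%:MP * _) mulrCA. Qed.

Lemma quotient_scaleAl c (x y : Q) : c *: (x * y) = (c *: x) * y.
Proof. by rewrite mulrC quotient_scaleAr mulrC. Qed.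

Lemma shifted_form_linear (phi : {linear Q -> k^o}) (x : Q) : linear (fun q : Q => phi (x * q)).
Proof. by move=> c u v; rewrite mulrDr -quotient_scaleAr linearP. Qed.

Definition shifted_form (phi : {linear Q -> k^o}) (x : Q) : {linear Q -> k^o} :=
  HB.pack (fun q : Q => phi (x * q)) (GRing.isLinear.Build k Q k^o _ _ (shifted_form_linear phi x)).

Lemma contract_sum d (a b : 'I_d -> Q) phi :
  contract (\sum_i a i ⊗ b i) phi = \sum_i (phi (a i) : k) *: b i.
Proof. by rewrite contractE linear_sum; apply: eq_bigr => i _; rewrite /= slice_tens. Qed.

Local Notation coord := (fun i : 'I_n => 'X_i : P).
Local Notation EP := (tensor_eval (double_var coord)).
Local Notation decomp := (decomposition (@inX k n) (@inY k n) f).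

Lemma residue2_decomposition_unique D D' : decomp D -> decomp D' ->
  residue2 f (EP (\det D)) = residue2 f (EP (\det D')).
Proof.
move=> HD HD'; pose L := tensor_map (residue f) (residue f).
apply: (decomposition_unique (@eval_inX k n) (@eval_inY k n) (L := L) _ _ HD HD').
  move=> j q r; rewrite /L /= tensor_map_tens /= residue_gen.
  by rewrite -(scale0r (0 : Q)) tensZl scale0r.
move=> j q r; rewrite /L /= tensor_map_tens /= residue_gen.
by rewrite -(scale0r (0 : Q)) tensZr scale0r.
Qed.

(** This is linearity over [Q] of the map [phi |-> contract Delta phi], where [Q] acts on
    functionals by [shifted_form]. *)
Lemma contract_shift D phi x : decomp D ->
  contract (residue2 f (EP (\det D))) (shifted_form phi x) =
    x * contract (residue2 f (EP (\det D))) phi.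
Proof.
move=> HD; rewrite -[x]residue_reprK !contractE residue2E.
pose l : {linear P -> k^o} := phi \o residue f.
pose l' : {linear P -> k^o} := shifted_form phi (residue f (repr x)) \o residue f.
rewrite (@slice_tensor_map _ _ _ _ _ _ _ _ l') // (@slice_tensor_map _ _ _ _ _ _ _ _ l) //.
pose L : {linear tensor P P -> Q} := residue f \o slice l.
rewrite -(@slice_tensl _ _ _ l _ (repr x)); last by move=> q; rewrite /l' /l /= rmorphM.
rewrite -[LHS]/(L _).
rewrite (eval_det_diagonal (@eval_inX k n) (@eval_inY k n) (@in_diff_span k n) _ _ _ HD) /=.
- by rewrite slice_tensr rmorphM.
- by move=> j q r; rewrite slice_tens /l /= residue_gen linear0 scale0r linear0.
- by move=> j q r; rewrite slice_tens linearZ /= residue_gen scaler0.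
Qed.

End QuotientBasis.

Section DualBases.
Variables (k : fieldType) (n : nat) (f : 'I_n -> {mpoly k[n]}).
Local Notation P := {mpoly k[n]}.
Local Notation Q := (quotient_algebra f).
Local Notation coord := (fun i : 'I_n => 'X_i : P).
Local Notation EP := (tensor_eval (double_var coord)).
Local Notation decomp := (decomposition (@inX k n) (@inY k n) f).

Variables (D : 'M[{mpoly k[n + n]}]_n) (HD : decomp D).
Let Delta : tensor Q Q := residue2 f (EP (\det D)).

(** With [b = M a] and [N l i = eta (a l * a i)], the expansion of [a l] in the [b i]
    reads [N *m M = 1].  Square matrices then also satisfy [M *m N = 1], and this is
    the duality. *)
Lemma dual_basis (eta : {linear Q -> k^o}) d (a b : 'I_d -> Q) :
    contract Delta eta = 1 -> linear_basis a -> Delta = \sum_i a i ⊗ b i ->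
  forall i j, eta (a i * b j) = (i == j)%:R.
Proof.
move=> eta1 basa Delta_ab.
have expand x : x = \sum_i (eta (x * a i) : k) *: b i.
  by rewrite -[LHS]mulr1 -eta1 -contract_shift // -/Delta Delta_ab contract_sum.
have coordP j := basa (b j).
pose M : 'M[k]_d := \matrix_(j, l) sval (cid (coordP j)) l.
have bE j : b j = \sum_l M j l *: a l.
  have [Ej _] := svalP (cid (coordP j)); rewrite {1}Ej.
  by apply: eq_bigr => l _; rewrite mxE.
pose N : 'M[k]_d := \matrix_(l, i) eta (a l * a i).
have NM : N *m M = 1%:M.
  apply/matrixP => l m; have [c [_ uniq_c]] := basa (a l).
  have c1 : c = [ffun m => (N *m M) l m].
    apply: uniq_c; rewrite {1}[a l]expand.
    under eq_bigr do rewrite bE scaler_sumr.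
    rewrite exchange_big; apply: eq_bigr => j _; rewrite ffunE mxE scaler_suml.
    by apply: eq_bigr => i _; rewrite scalerA [N l i]mxE.
  have c2 : c = [ffun m => (1%:M : 'M[k]_d) l m].
    apply: uniq_c; rewrite (bigD1 l) //= ffunE mxE eqxx scale1r big1 ?addr0 // => j nj.
    by rewrite ffunE mxE eq_sym (negPf nj) mulr0n scale0r.
  by have /ffunP/(_ m) := etrans (esym c1) c2; rewrite !ffunE.
have MN := mulmx1C NM.
move=> i j; have /matrixP/(_ j i) := MN; rewrite [RHS]mxE eq_sym => <-.
rewrite bE mulr_sumr linear_sum mxE; apply: eq_bigr => l _ /=.
by rewrite -quotient_scaleAr linearZ [N l i]mxE mulrC.
Qed.

(** For the dual bases of [eta] one has [eta (a j * b i) = delta_ij], so applying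
    [eta (a j * _)] to [\sum_i phi (a i) b i = 1] recovers [phi (a j)]. *)
Lemma contract1_unique (eta eta' : {linear Q -> k^o}) :
    (exists d (a : 'I_d -> Q), linear_basis a) ->
  contract Delta eta = 1 -> contract Delta eta' = 1 -> eta =1 eta'.
Proof.
move=> [d [a basa]] eta1 eta1'; have [b Delta_ab] := basis_tensor Delta basa.
have dual := dual_basis eta1 basa Delta_ab.
have aE j : eta (a j) = eta' (a j).
  have val (phi : {linear Q -> k^o}) : contract Delta phi = 1 -> eta (a j) = phi (a j).
    rewrite Delta_ab contract_sum => phi1; rewrite -[a j in LHS]mulr1 -phi1 mulr_sumr linear_sum.
    rewrite (bigD1 j) //= -quotient_scaleAr linearZ dual eqxx big1 ?addr0.
      by rewrite /= /GRing.scale /= mulr1.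
    move=> i ni; rewrite -quotient_scaleAr linearZ dual eq_sym (negPf ni).
    by rewrite /= /GRing.scale /= mulr0.
  exact: val.
move=> x; have [c [-> _]] := basa x; rewrite !linear_sum; apply: eq_bigr => j _ /=.
by rewrite !linearZ aE.
Qed.

(** Let [s] be the contraction.  Shifting by [b j] gives [b j * s = b j], and [1] is a
    combination of the [b j] because [eta] contracts [Delta] to it; so [s = 1]. *)
Lemma bezoutian_contract1 (eta lambda : {linear Q -> k^o}) d (a b : 'I_d -> Q) :
    contract Delta eta = 1 -> Delta = \sum_i a i ⊗ b i ->
    (forall i j, lambda (a i * b j) = (i == j)%:R) ->
  contract Delta lambda = 1.
Proof.
move=> eta1 Delta_ab dual; set s := contract Delta lambda.
have bs j : b j * s = b j.
  rewrite /s -contract_shift // -/Delta Delta_ab contract_sum (bigD1 j) //=.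
  rewrite mulrC dual eqxx scale1r big1 ?addr0 // => i ni.
  by rewrite mulrC dual (negPf ni) scale0r.
rewrite -[s]mul1r -eta1 Delta_ab contract_sum mulr_suml; apply: eq_bigr => i _.
by rewrite -quotient_scaleAl bs.
Qed.

End DualBases.

Theorem lemma4p4 (k : fieldType) (n : nat) (f : 'I_n -> {mpoly k[n]})
    (hf : only_isolated_zeros f) :
  exists B : quotient_algebra f -> quotient_algebra f -> k,
    unique (is_bezoutian_form (f := f)) B /\
    unique (is_scheja_storch_form (f := f)) B.
Proof.
have [D0 HD0] := bezout_matrix_exists f.
have dec0 := bezout_decomposition HD0.
have [eta eta1] := exists_contract1 hf dec0.
have basis := quotient_basis hf.
pose EP := tensor_eval (double_var (fun i : 'I_n => 'X_i : {mpoly k[n]})).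
have SS_unique B : is_scheja_storch_form B -> mult_form eta = B.
  case=> a [eta' [Ha eta1' EB]]; subst B.
  have [decA detA] := decomposition_map (@eval_inX k n) (@eval_inY k n)
    (@inX_var k n) (@inY_var k n) Ha.
  have eta_eq : eta =1 eta'.
    apply: (contract1_unique dec0 basis eta1).
    by rewrite (residue2_decomposition_unique dec0 decA) detA.
  by apply: funext => x; apply: funext => y; apply: eta_eq.
have SS_eta : is_scheja_storch_form (mult_form eta).
  exists (map_mx EP D0^T), eta; split=> //.
    by move=> j; apply: (decomposition_eval (@eval_inX k n) (@eval_inY k n) dec0).
  by rewrite det_map_mx.
exists (mult_form eta); split; split=> // [|B [D [d [a [b [lambda [HD _ Dab dual ->]]]]]]].
  have [d [a basa]] := basis.
  have [b Dab] := basis_tensor (residue2 f (EP (\det D0^T))) basa.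
  exists D0, d, a, b, eta; split=> //.
    by rewrite bezout_evalE -det_tr.
  exact: (dual_basis dec0 eta1 basa Dab).
have decD := bezout_decomposition HD.
apply: SS_unique; exists (map_mx EP D^T), lambda; split=> //.
  by move=> j; apply: (decomposition_eval (@eval_inX k n) (@eval_inY k n) decD).
rewrite det_map_mx.
have Dab' : residue2 f (EP (\det D^T)) = \sum_i a i ⊗ b i.
  by rewrite det_tr -[EP _]/(bezout_eval _).
have [eta' eta1D] := exists_contract1 hf decD.
exact: (bezoutian_contract1 decD eta1D Dab' dual).
Qed.
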